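(* For all knots $K\subset S^3$ (and all odd primes $p$ in (iii)), we have: (i) $\mathfrak{u}_G(K)=\nu(K)$; (ii) $\mathfrak{u}_G(K)\ge\mathfrak{u}_X(K)$; (iii) $\lambda(K)\ge\mathfrak{u}_{(X,p)}(K)$; (iv) $\lambda(K)\ge\mathfrak{u}_h(K)$.
   Context: For a graded module $M$, $M\{m\}_n=M_{n-m}$. **Unreduced complexes.** Let $R$ be a commutative ring with chosen elements $h,t\in R$, $A=R[X]/(X^2-hX-t)$ with multiplication $m$ and comultiplication $\Delta(1)=1\otimes X+X\otimes1-h\,1\otimes1$, $\Delta(X)=X\otimes X+t\,1\otimes1$. Let $D$ be a diagram of an oriented knot $K$ with a base point away from crossings, with $n_\pm$ positive/negative crossings. At each crossing the orientation-compatible resolution is the 0-resolution for positive and the 1-resolution for negative crossings. To a complete resolution with $k+1$ circles associate $A\{1\}^{\otimes(k+1)}$ (over $R$), an $A$-module via the factor of the circle containing the base point; to an edge of the cube of resolutions (one 0-resolution changed to a 1-resolution) associate $m$ on the factors of two merging circles or $\Delta$ on the factor of a splitting circle, with the usual signs. A resolution with $r$ 1-resolutions sits in homological degree $r-n_-$ with additional shift $\{r+n_+-2n_-\}$. The resulting complex of $A$-modules (up to homotopy equivalence an invariant of $K$) is the unreduced complex of $K$ for the Frobenius algebra $A$ over $R$; its homology is the unreduced homology. **$\llbracket K\rrbracket$ and $\lambda$.** Take $R=\mathbb{Z}[G]$ (polynomial ring), $h=-G$, $t=0$, so $A=\mathbb{Z}[G][X]/(X^2+GX)$, and let $\llbracket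 K\rrbracket$ be the unreduced complex tensored over $A$ with $A/(X)\{-1\}$, a complex of free $\mathbb{Z}[G]$-modules. For the unknot $U$, $\llbracket U\rrbracket\simeq\mathbb{Z}[G]$ in homological degree $0$. $\lambda(K)$ is the minimal $k\ge0$ such that there are ungraded chain maps ($\mathbb{Z}[G]$-linear maps commuting with differentials, not required to respect homological or quantum degree) $f\colon\llbracket K\rrbracket\to\llbracket U\rrbracket$, $g\colon\llbracket U\rrbracket\to\llbracket K\rrbracket$ and (ungraded) homotopies $g\circ f\simeq G^k\cdot\mathrm{id}$, $f\circ g\simeq G^k\cdot\mathrm{id}$ (and $\infty$ if no such $k$ exists). **Torsion orders.** For a module $H$ over a commutative ring and a ring element $r$, an element $a\in H$ is $r$-torsion if $r^na=0$ for some $n\ge0$; its order is the minimal such $n$; the maximal $r$-torsion order of $H$ is the maximum of the orders of its $r$-torsion elements. - $\mathfrak{u}_G(K)$: maximal $G$-torsion order of $H(\llbracket K\rrbracket)$ (as $\mathbb{Z}[G]$-module). - $\nu(K)$: maximal $(2X-(\alpha_1+\alpha_2))$-torsion order of the unreduced homology for $\mathbb{Z}[X,\alpha_1,\alpha_2]/((X-\alpha_1)(X-\alpha_2))$ over $R=\mathbb{Z}[\alpha_1,\alpha_2]$ ($h=\alpha_1+\alpha_2$, $t=-\alpha_1\alpha_2$). - $\mathfrak{u}_X(K)$: maximal $X$-torsion order of the unreduced homology for $\mathbb{Q}[t,X]/(X^2-t)\cong\mathbb{Q}[X]$ over $R=\mathbb{Q}[t]$ ($h=0$). - $\mathfrak{u}_{(X,p)}(K)$,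 $p$ an odd prime: the same with $\mathbb{Q}$ replaced by $\mathbb{F}_p$. - $\mathfrak{u}_h(K)$: maximal $h$-torsion order of the unreduced homology for $\mathbb{F}_2[h,X]/(X^2+hX)$ over $R=\mathbb{F}_2[h]$ ($t=0$). *)

(* Defs.v *)
From HB Require Import structures.
From mathcomp Require Import all_boot all_algebra.
From mathcomp Require Import boolp.

Set Implicit Arguments.
Unset Strict Implicit.
Unset Printing Implicit Defensive.

Import GRing.Theory.
Local Open Scope ring_scope.
Local Open Scope quotient_scope.

(* [None] is infinity. *)
Definition enat := option nat.

Definition enat_le (x y : enat) : bool :=
  match x, y with
  | _, None => true
  | None, Some _ => false
  | Some m, Some n => (m <= n)%N
  end.

Definition enat_min (P : nat -> Prop) : enat :=
  match pselect (exists n, `[< P n >]) with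
  | left exP => Some (ex_minn exP)
  | right _ => None
  end.

Lemma enat_minP (P : nat -> Prop) (n : nat) :
  enat_min P = Some n <-> P n /\ forall m, P m -> (n <= m)%N.
Proof.
rewrite /enat_min; case: pselect => [exP|noP]; last first.
  by split=> [//|[Pn _]]; case: noP; exists n; apply/asboolP.
case: ex_minnP => k /asboolP Pk mink; split=> [[<-]|[Pn minn]].
  by split=> // m Pm; apply/mink/asboolP.
by congr Some; apply/anti_leq; rewrite minn // mink //; apply/asboolP.
Qed.

(* The total module of a bounded complex of finitely generated free modules,
   with the matrix of its differential acting on row vectors. The homology is
   then the direct sum of the homology modules in all degrees. That the
   differential squares to zero is not recorded: homology is defined as the
   quotient of the cycles by those cycles that are boundaries. *)
Record free_complex (B : comNzRingType) := FreeComplex {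
  rank : nat;
  diff_mx : 'M[B]_rank
}.

Section Homology.
Variables (B : comNzRingType) (C : free_complex B).

Local Notation chain := 'rV[B]_(rank C).

Definition diff (u : chain) : chain := u *m diff_mx C.

Fact diff_is_linear : linear diff.
Proof. by move=> a u v; rewrite /diff mulmxDl -scalemxAl. Qed.
HB.instance Definition _ :=
  GRing.isLinear.Build B chain chain _ diff diff_is_linear.

Definition is_cycle : {pred chain} := fun u => diff u == 0.

Fact is_cycle_submod : submod_closed is_cycle.
Proof.
split=> [|a u v]; rewrite !unfold_in ?linear0 // => /eqP du /eqP dv.
by rewrite linearP /= du dv scaler0 addr0.
Qed.
HB.instance Definition _ :=
  GRing.isSubmodClosed.Build B chain is_cycle is_cycle_submod.

Record cycle := Cycle { cycle_val :> chain; _ : cycle_val \in is_cycle }.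
HB.instance Definition _ := [isSub for cycle_val].
HB.instance Definition _ := [Choice of cycle by <:].
HB.instance Definition _ := [SubChoice_isSubLmodule of cycle by <:].

Definition is_boundary : {pred cycle} :=
  fun z => `[< exists w : chain, val z = diff w >].

Fact is_boundary_submod : submod_closed is_boundary.
Proof.
split=> [|a y z /asboolP[v vE] /asboolP[w wE]]; apply/asboolP.
  by exists 0; rewrite linear0 raddf0.
by exists (a *: v + w); rewrite !linearP /= vE wE.
Qed.
HB.instance Definition _ :=
  GRing.isSubmodClosed.Build B cycle is_boundary is_boundary_submod.

(* The quotient of the cycles by the boundaries, with its Zmodule structure
   from [ring_quotient]; the module structure is added here. *)
Definition homology := Quotient.quot is_boundary.
HB.instance Definition _ := EqQuotient.on homology.
HB.instance Definition _ := GRing.Zmodule.on homology.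

Definition homology_class (z : cycle) : homology := \pi_homology z.

Lemma homology_classD (y z : cycle) :
  homology_class (y + z) = homology_class y + homology_class z.
Proof. exact: (raddfD (\pi_(Quotient.quot is_boundary))). Qed.

Lemma homology_class_eqP (y z : cycle) :
  reflect (exists w : chain, val (y - z) = diff w)
          (homology_class y == homology_class z).
Proof. by rewrite -[_ == _]Quotient.idealrBE; apply: asboolP. Qed.

Definition homology_scale (a : B) (x : homology) : homology :=
  homology_class (a *: repr x).

Lemma homology_classK (x : homology) : homology_class (repr x) = x.
Proof. exact: reprK. Qed.

Lemma homology_class_scale (a : B) (z : cycle) :
  homology_scale a (homology_class z) = homology_class (a *: z).
Proof.
apply/eqP/homology_class_eqP.
have /eqP/homology_class_eqP[w wE] := homology_classK (homology_class z).
by exists (a *: w); rewrite -scalerBr [RHS]linearZ /= -wE.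
Qed.

Fact homology_scaleA a b x :
  homology_scale a (homology_scale b x) = homology_scale (a * b) x.
Proof. by rewrite -[x]homology_classK !homology_class_scale scalerA. Qed.

Fact homology_scale1 : left_id 1 homology_scale.
Proof. by move=> x; rewrite -[x]homology_classK homology_class_scale scale1r. Qed.

Fact homology_scaleDr : right_distributive homology_scale +%R.
Proof.
move=> a x y; rewrite -[x]homology_classK -[y]homology_classK.
by rewrite -homology_classD !homology_class_scale -homology_classD scalerDr.
Qed.

Fact homology_scaleDl x : {morph homology_scale^~ x : a b / a + b}.
Proof.
move=> a b; rewrite -[x]homology_classK !homology_class_scale.
by rewrite -homology_classD scalerDl.
Qed.

HB.instance Definition _ := GRing.Zmodule_isLmodule.Build B homology
  homology_scaleA homology_scale1 homology_scaleDr homology_scaleDl.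

Lemma homology_classZ (a : B) (z : cycle) :
  homology_class (a *: z) = a *: homology_class z.
Proof. by rewrite -homology_class_scale. Qed.

End Homology.

Section TorsionOrder.
Variables (B : comNzRingType) (H : lmodType B) (r : B).

(* [None] exactly when [a] is not [r]-torsion. *)
Definition torsion_order (a : H) : enat := enat_min (fun n => r ^+ n *: a = 0).

(* The least upper bound of the orders of the torsion elements, that is their
   maximum when they are bounded. *)
Definition max_torsion_order : enat :=
  enat_min (fun N => forall a n, torsion_order a = Some n -> (n <= N)%N).

End TorsionOrder.

Section ChainMaps.
Variable B : comNzRingType.
Implicit Types C D : free_complex B.

Definition is_chain_map C D (f : 'rV[B]_(rank C) -> 'rV[B]_(rank D)) : Prop :=
  forall u, f (diff u) = diff (f u).

Definition homotopic C D (f g : 'rV[B]_(rank C) -> 'rV[B]_(rank D)) : Prop :=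
  exists k : {linear 'rV[B]_(rank C) -> 'rV[B]_(rank D)},
    forall u, f u - g u = diff (k u) + k (diff u).

Definition equivalent_up_to (r : B) C D : Prop :=
  exists (f : {linear 'rV[B]_(rank C) -> 'rV[B]_(rank D)})
         (g : {linear 'rV[B]_(rank D) -> 'rV[B]_(rank C)}),
    [/\ is_chain_map f, is_chain_map g,
        homotopic (g \o f) ( *:%R r) & homotopic (f \o g) ( *:%R r)].

End ChainMaps.

(* Tensoring a based free module along [phi] keeps the basis and applies [phi]
   to the entries of the differential. *)
Definition base_change (A B : comNzRingType) (phi : A -> B)
  (C : free_complex A) : free_complex B := FreeComplex (map_mx phi (diff_mx C)).

Section Gluing.
Variables (I T : finType) (s : I -> seq (T * T)).

Definition gluing : rel T :=
  [rel a b | [exists c, ((a, b) \in s c) || ((b, a) \in s c)]].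

End Gluing.

(* A signed Gauss code. Walking along the oriented knot from the base point one
   meets the arcs 0, 1, ..., 2n - 1 of the diagram in this order; the base point
   lies on the arc 0. The arc [arc_in c b] runs into the crossing [c], on the
   upper strand if [b] and on the lower strand otherwise, and continues behind
   it as the cyclically next arc. The diagram without crossings has one arc. *)
Record gauss_code := GaussCode {
  ncross : nat;
  positive : 'I_ncross -> bool;
  arc_in : 'I_ncross -> bool -> 'I_(ncross.*2).-1.+1;
  arc_in_inj : injective (fun p : 'I_ncross * bool => arc_in p.1 p.2)
}.

Definition arc (D : gauss_code) := 'I_((ncross D).*2).-1.+1.
HB.instance Definition _ D := Finite.on (arc D).

Definition arc_out (D : gauss_code) (c : 'I_(ncross D)) (b : bool) : arc D :=
  ordS (arc_in c b).

(* [(a, true)] and [(a, false)] are the left and the right side of the arc [a].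
   Turn the crossing so that both strands point upwards. The strand from the
   lower left to the upper right is the upper strand iff the crossing is
   positive; call its arcs [p], [p'] and those of the other strand [q], [q'].
   Listed are the pairs of sides that bound the same region to the right of,
   above, to the left of and below the crossing. *)
Definition corners (D : gauss_code) (c : 'I_(ncross D)) :
    seq ((arc D * bool) * (arc D * bool)) :=
  let p := arc_in c (positive c) in let p' := arc_out c (positive c) in
  let q := arc_in c (~~ positive c) in let q' := arc_out c (~~ positive c) in
  [:: ((q, false), (p', false)); ((p', true), (q', false));
      ((q', true), (p, true)); ((p, false), (q, true))].

(* Every signed Gauss code describes a knot diagram on a closed oriented
   surface with n vertices, 2n edges (if n > 0) and discs as regions; the
   surface is the sphere iff there are n + 2 regions. *)
Definition regions (D : gauss_code) : nat := n_comp (gluing (@corners D)) predT.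

Record knot_diagram := KnotDiagram {
  code :> gauss_code;
  planar : regions code = (ncross code).+2
}.

Definition unknot_code : gauss_code.
Proof.
by refine (@GaussCode 0 (fun=> true) (fun _ _ => ord0) _); case=> -[].
Defined.

Fact unknot_planar : regions unknot_code = 2.
Proof.
rewrite /regions.
have con x y : connect (gluing (@corners unknot_code)) x y = (x == y).
  apply/connectP/eqP => [[[|z p] //= /andP[/existsP[[]]]]|->]; by [|exists [::]].
have rootE x : roots (gluing (@corners unknot_code)) x.
  by have := connect_root (gluing (@corners unknot_code)) x; rewrite con eq_sym.
transitivity #|{: 'I_1 * bool}|; last by rewrite card_prod card_ord card_bool.
by apply: (@eq_card) => x; rewrite !inE rootE.
Qed.

Definition unknot : knot_diagram := KnotDiagram unknot_planar.

Definition frob_poly (R : comNzRingType) (h t : R) : {poly R} :=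
  'X^2 - h *: 'X - t%:P.

Notation frob h t := {poly %/ frob_poly h t}.

Section Frobenius.
Variables (R : comNzRingType) (h t : R).
Local Notation A := (frob h t).

Definition frobX : A := 'qX.

(* [true] and [false] stand for the elements X and 1 of the basis of A. *)
Definition basisA (b : bool) : A := frobX ^+ b.

(* The coefficient of the basis element [k] in the product of [i] and [j]. *)
Definition mul_coef (i j k : bool) : R :=
  ((basisA i * basisA j : A) : {poly R})`_k.

(* The coefficient of the tensor product of [j] and [k] in Delta(i), where
   Delta(1) = 1 (x) X + X (x) 1 - h 1 (x) 1 and
   Delta(X) = X (x) X + t 1 (x) 1. *)
Definition comul_coef (i j k : bool) : R :=
  match i, j, k with
  | false, false, true | false, true, false => 1
  | false, false, false => - h
  | false, true, true => 0
  | true, true, true => 1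
  | true, false, false => t
  | true, _, _ => 0
  end.

Fact size_frob_poly : size (frob_poly h t) = 3.
Proof.
rewrite /frob_poly -addrA size_polyDl ?size_polyXn // -opprD size_polyN.
rewrite (leq_ltn_trans (size_polyD _ _)) // gtn_max size_polyC.
by rewrite (leq_ltn_trans (size_scale_leq _ _)) ?size_polyX //; case: eqP.
Qed.

Fact frob_poly_monic : frob_poly h t \is monic.
Proof.
rewrite monicE lead_coefE size_frob_poly /frob_poly !coefE /=.
by rewrite mulr0 !subr0.
Qed.

Fact mk_monic_frob : mk_monic (frob_poly h t) = frob_poly h t.
Proof. by rewrite /mk_monic size_frob_poly frob_poly_monic. Qed.

Lemma frobX_sqr : frobX ^+ 2 = h *: frobX + t%:A.
Proof.
have p0 : in_qpoly (frob_poly h t) (frob_poly h t) = 0 :> A.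
  by apply: val_inj; rewrite /= mk_monic_frob Pdiv.RingMonic.rmodpp ?frob_poly_monic.
have X2 : 'X^2 = frob_poly h t + h *: 'X + t *: 1.
  by rewrite /frob_poly alg_polyC addrAC !subrK.
rewrite /frobX /qpolyX -rmorphXn /= X2.
rewrite (in_qpolyD _ (_ + _)) (in_qpolyD _ (frob_poly h t)) p0 add0r !in_qpolyZ.
by rewrite in_qpoly1.
Qed.

Lemma frobE (a : A) : a = \sum_(b : bool) (a : {poly R})`_b *: basisA b.
Proof.
have X1 : frobX = 'X :> {poly R}.
  by rewrite /frobX qpolyXE ?size_frob_poly ?frob_poly_monic.
have sa : (size (a : {poly R}) <= 2)%N.
  by rewrite (leq_trans (size_npoly a)) // mk_monic_frob size_frob_poly.
have aE : a = a`_1 *: 'X + a`_0 *: 1 :> {poly R}.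
  apply/polyP => -[|[|i]]; rewrite !coefE ?mulr0 ?mulr1 ?add0r ?addr0 //=.
  by rewrite nth_default // (leq_trans sa).
rewrite big_bool /basisA [_ ^+ true]expr1 [_ ^+ false]expr0.
by apply: val_inj; rewrite [LHS]aE -[in LHS]X1.
Qed.

Lemma mul_coefP (i j : bool) :
  \sum_(k : bool) mul_coef i j k *: basisA k = basisA i * basisA j.
Proof. by rewrite [RHS]frobE. Qed.

(* Delta is A-linear for the action of A on its first factor. *)
Lemma comul_coef_linear (i k : bool) :
  \sum_(j : bool) comul_coef i j k *: basisA j =
  basisA i * \sum_(j : bool) comul_coef false j k *: basisA j.
Proof.
rewrite !big_bool /= /basisA expr0 expr1.
case: i k => -[] /=; rewrite ?mul1r ?scale0r ?scale1r ?addr0 ?add0r //.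
  by rewrite mulr1.
rewrite mulrDr -expr2 frobX_sqr -scalerAr mulr1 scaleNr addrAC subrr.
by rewrite add0r.
Qed.

Lemma comul_coefC (i j k : bool) : comul_coef i j k = comul_coef i k j.
Proof. by case: i j k => -[] []. Qed.

End Frobenius.

Section Cube.
Variable D : gauss_code.

Local Notation crossing := 'I_(ncross D).
Local Notation arc := (arc D).

(* [v c] tells whether [c] is 1-resolved. *)
Definition resolution := {ffun crossing -> bool}.
Implicit Types (v w : resolution) (c : crossing) (a : arc).

(* The two pairs of arcs joined at [c]. Joining the incoming arc of each strand
   to the outgoing arc of the other one is compatible with the orientation: this
   is the 0-resolution if [c] is positive and the 1-resolution otherwise. *)
Definition joins v c : seq (arc * arc) :=
  if v c == ~~ positive c
  then [:: (arc_in c true, arc_out c false); (arc_in c false, arc_out c true)]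
  else [:: (arc_in c true, arc_in c false); (arc_out c true, arc_out c false)].

(* Whether two arcs lie on the same circle of the resolution [v]. *)
Definition circle v : rel arc := connect (gluing (joins v)).

(* A basis element of A^{(x) circles}: a label 1 ([false]) or X ([true]) for
   each circle, as a function of the arcs that is constant on the circles. *)
Definition labelling := {ffun arc -> bool}.
Implicit Types l : labelling.

Definition set_base v (b : bool) l : labelling :=
  [ffun a => if circle v ord0 a then b else l a].

(* The labelled resolutions whose base circle has the label 1: a basis of the
   total module over A, where A acts on the factor of the base circle. *)
Definition states : {set resolution * labelling} :=
  [set s : resolution * labelling |
    [forall a, forall a', circle s.1 a a' ==> (s.2 a == s.2 a')]
    && ~~ s.2 ord0].

Definition raise v c : resolution := [ffun c' => (c' == c) || v c'].

Variables (R : comNzRingType) (h t : R).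
Local Notation A := (frob h t).

(* The coefficient of the labelling [l'] of [raise v c] in the image of the
   labelling [l] of [v] under the map of the edge of the cube that changes [c].
   In both resolutions the arcs [x] and [y] represent the (at most two) circles
   near [c]: they merge or split. The last case does not occur if the diagram is
   planar. *)
Definition edge_coef v c l l' : R :=
  let w := raise v c in
  let x := arc_in c true in let y := arc_out c true in
  if [forall a, ~~ circle v x a && ~~ circle v y a ==> (l a == l' a)] then
    if ~~ circle v x y && circle w x y then mul_coef h t (l x) (l y) (l' x)
    else if circle v x y && ~~ circle w x y
    then comul_coef h t (l x) (l' x) (l' y)
    else 0
  else 0.

(* The matrix of the differential over R, in the basis of labelled
   resolutions. *)
Definition cube_coef (s s' : resolution * labelling) : R :=
  \sum_(c | ~~ s.1 c && (s'.1 == raise s.1 c))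
    (-1) ^+ #|[set c' : crossing | (c' < c)%N && s.1 c']|
    * edge_coef s.1 c s.2 s'.2.

(* The A-coefficient of [s'] in the differential of [s]. The differential over R
   is A-linear, see [cube_coef_linear] below, and so it is determined by its
   values on the labelled resolutions whose base circle has the label 1. *)
Definition cube_coefA (s s' : resolution * labelling) : A :=
  \sum_(b : bool)
    cube_coef s (s'.1, set_base s'.1 b s'.2) *: basisA h t b.

(* The unreduced complex, as a complex of free A-modules. The shifts of the
   gradings are omitted: neither torsion orders nor ungraded maps see them. *)
Definition unreduced : free_complex A :=
  FreeComplex (\matrix_(i < #|states|, j < #|states|)
                 cube_coefA (enum_val i) (enum_val j)).

Lemma gluing_sym (I T : finType) (s : I -> seq (T * T)) : symmetric (gluing s).
Proof. by move=> a b; apply: eq_existsb => c; rewrite orbC. Qed.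

Lemma circle_refl v : reflexive (circle v). Proof. exact: connect0. Qed.

Lemma circle_sym v : symmetric (circle v).
Proof. exact/sym_connect_sym/gluing_sym. Qed.

Lemma circle_trans v : transitive (circle v). Proof. exact: connect_trans. Qed.

Definition near c a : bool :=
  [|| a == arc_in c true, a == arc_out c true,
      a == arc_in c false | a == arc_out c false].

Lemma near_circle v c a : near c a ->
  circle v (arc_in c true) a || circle v (arc_out c true) a.
Proof.
have jc p : p \in joins v c -> circle v p.1 p.2.
  case: p => p q jpq; apply: connect1; apply/existsP; exists c.
  by rewrite /= jpq.
move: jc; rewrite /joins; case: ifP => _ jc.
  have := jc (_, _) (mem_head _ _).
  have := jc (_, _) (mem_last _ [:: _]); rewrite /= => j2 j1.
  case/or4P => /eqP ->; rewrite ?circle_refl ?orbT // ?j1 // circle_sym.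
  by rewrite [X in _ || X]circle_sym j2 orbT.
have := jc (_, _) (mem_head _ _).
have := jc (_, _) (mem_last _ [:: _]); rewrite /= => j2 j1.
by case/or4P => /eqP ->; rewrite ?circle_refl ?orbT // ?j1 // j2 orbT.
Qed.

Lemma gluing_raise v c a a' : ~~ near c a ->
  gluing (joins v) a a' = gluing (joins (raise v c)) a a'.
Proof.
move=> na; apply: eq_existsb => c'; rewrite /joins ffunE.
have [->|//] := eqVneq c' c; move: na; rewrite /near !negb_or.
by case/and4P => /negPf n1 /negPf n2 /negPf n3 /negPf n4;
   do 2![case: ifP => _]; rewrite !inE !xpair_eqE n1 n2 n3 n4 ?andbF.
Qed.

(* A circle that does not touch the crossing is not changed. *)
Lemma circle_raise_far v w c a a' :
    (w = raise v c) -> ~~ circle v (arc_in c true) a ->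
    ~~ circle v (arc_out c true) a ->
  circle v a a' = circle w a a'.
Proof.
move=> -> nx ny.
have far z : circle v a z -> ~~ near c z.
  move=> az; apply: contra nx => /near_circle -/(_ v).
  case/orP => xz; rewrite circle_sym in az.
    exact: circle_trans xz az.
  by rewrite (circle_trans xz az) in ny.
apply/idP/idP => /connectP[p pP ->]; elim/last_ind: p pP => [|p z IHp];
    rewrite ?circle_refl // rcons_path last_rcons => /andP[pP zP].
  have pz : circle v a (last a p) by apply/connectP; exists p.
  apply: circle_trans (IHp pP) _; apply: connect1.
  by rewrite -gluing_raise // far.
apply: circle_trans (IHp pP) _; apply: connect1.
by rewrite (gluing_raise _ _ (far _ (IHp pP))).
Qed.

(* Every arc of a circle that touches the crossing still does. *)
Lemma circle_raise_near v c a :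
    circle v (arc_in c true) a || circle v (arc_out c true) a ->
  circle (raise v c) (arc_in c true) a || circle (raise v c) (arc_out c true) a.
Proof.
have step z z' : circle (raise v c) (arc_in c true) z ||
    circle (raise v c) (arc_out c true) z -> gluing (joins v) z z' ->
  circle (raise v c) (arc_in c true) z' || circle (raise v c) (arc_out c true) z'.
  have [nz' _ _|nz'] := boolP (near c z'); first exact: near_circle.
  rewrite gluing_sym (gluing_raise _ _ nz') gluing_sym => zP /connect1 zz'.
  case/orP: zP => zP; apply/orP; [left|right]; exact: connect_trans zP zz'.
case/orP => /connectP[p pP ->]; elim/last_ind: p pP => [|p z IHp];
    rewrite ?circle_refl ?orbT // rcons_path last_rcons => /andP[pP zP];
  exact: step (IHp pP) zP.
Qed.

Lemma sum_zero_linear :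
  \sum_(b : bool) 0 *: basisA h t b
  = basisA h t true * \sum_(b : bool) 0 *: basisA h t b.
Proof.
move: (A : comAlgType R) (basisA h t : bool -> A) => B f.
by rewrite !big1 ?mulr0 // => b _; rewrite scale0r.
Qed.

Lemma sum_delta_linear (k : R) :
  \sum_(b : bool) (if true == b then k else 0) *: basisA h t b
  = basisA h t true *
    \sum_(b : bool) (if false == b then k else 0) *: basisA h t b.
Proof.
have aux (f : bool -> A) : f false = 1 ->
    \sum_(b : bool) (if true == b then k else 0) *: f b
    = f true * \sum_(b : bool) (if false == b then k else 0) *: f b.
  move: (A : comAlgType R) f => {}B f f1.
  by rewrite !big_bool /= !scale0r addr0 add0r f1 -scalerAr mulr1.
exact/aux/expr0.
Qed.

Lemma edge_coef_linear v c l l' :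
  let w := raise v c in
  \sum_(b : bool) edge_coef v c (set_base v true l) (set_base w b l')
    *: basisA h t b
  = basisA h t true *
    \sum_(b : bool) edge_coef v c (set_base v false l) (set_base w b l')
      *: basisA h t b.
Proof.
move=> w; pose x := arc_in c true; pose y := arc_out c true.
have cC := circle_sym; have cT u : transitive (circle u) := @circle_trans u.
have [near0|far0] := boolP (circle v x ord0 || circle v y ord0); last first.
  have [nx ny] : ~~ circle v x ord0 /\ ~~ circle v y ord0 by apply/norP.
  have c0 a : circle w ord0 a = circle v ord0 a by rewrite -(circle_raise_far _ erefl).
  have E b b' : edge_coef v c (set_base v b l) (set_base w b' l') =
      if b == b' then edge_coef v c (set_base v false l) (set_base w false l') else 0.
    rewrite /edge_coef -/w -/x -/y !ffunE !c0 ![circle v ord0 _]cC (negPf nx) (negPf ny).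
    have [<-|neq_b] := eqVneq b b'.
      congr (if _ then _ else _); apply: eq_forallb => a; rewrite !ffunE c0.
      by case: ifP => // _; rewrite !eqxx.
    case: ifP => // /forallP/(_ ord0); rewrite nx ny !ffunE c0 circle_refl /=.
    by rewrite (negPf neq_b).
  under eq_bigr do rewrite E; under [in RHS]eq_bigr do rewrite E.
  exact: sum_delta_linear.
have near0w : circle w x ord0 || circle w y ord0 by apply: circle_raise_near.
have G b b' : [forall a, ~~ circle v x a && ~~ circle v y a ==>
    (set_base v b l a == set_base w b' l' a)]
    = [forall a, ~~ circle v x a && ~~ circle v y a ==> (l a == l' a)].
  apply: eq_forallb => a; have [/andP[nx ny]|//] := boolP (_ && _).
  have F : circle v ord0 a = false.
    apply/negP => c0a; case/orP: near0 => z0; have := cT v _ _ _ z0 c0a.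
      by rewrite (negPf nx).
    by rewrite (negPf ny).
  by rewrite !ffunE F [circle w _ _]cC -(circle_raise_far _ erefl nx ny) cC F.
rewrite /edge_coef; under eq_bigr do rewrite G; under [in RHS]eq_bigr do rewrite G.
rewrite -/w -/x -/y.
case: [forall a, ~~ circle v x a && ~~ circle v y a ==> (l a == l' a)];
  last exact: sum_zero_linear.
case: (boolP (~~ circle v x y && circle w x y)) => [/andP[nxy wxy]|_];
  last case: (boolP (circle v x y && ~~ circle w x y)) => [/andP[vxy nwxy]|_].
- have w0x : circle w ord0 x.
    by case/orP: near0w => z0; rewrite cC // (cT _ _ _ _ wxy).
  have [x0|nx0] := boolP (circle v x ord0).
    have y0 : circle v ord0 y = false.
      by apply: contraNF nxy; apply: (cT).
    under eq_bigr do rewrite !ffunE y0 w0x [circle v ord0 x]cC x0.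
    under [in RHS]eq_bigr do rewrite !ffunE y0 w0x [circle v ord0 x]cC x0.
    by rewrite !mul_coefP [basisA h t false]expr0 mul1r.
  have y0 : circle v y ord0 by rewrite (negPf nx0) in near0.
  under eq_bigr do rewrite !ffunE w0x ![circle v ord0 _]cC y0 (negPf nx0).
  under [in RHS]eq_bigr do rewrite !ffunE w0x ![circle v ord0 _]cC y0 (negPf nx0).
  by rewrite !mul_coefP [basisA h t false]expr0 mulr1 mulrC.
- have v0x : circle v ord0 x.
    by case/orP: near0 => z0; rewrite cC // (cT _ _ _ _ vxy).
  have [x0|nx0] := boolP (circle w x ord0).
    have y0 : circle w ord0 y = false.
      by apply: contraNF nwxy; apply: (cT).
    under eq_bigr do rewrite !ffunE v0x y0 [circle w ord0 x]cC x0.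
    under [in RHS]eq_bigr do rewrite !ffunE v0x y0 [circle w ord0 x]cC x0.
    exact: comul_coef_linear.
  have y0 : circle w y ord0 by rewrite (negPf nx0) in near0w.
  under eq_bigr do rewrite !ffunE v0x ![circle w ord0 _]cC y0 (negPf nx0) comul_coefC.
  under [in RHS]eq_bigr do
    rewrite !ffunE v0x ![circle w ord0 _]cC y0 (negPf nx0) comul_coefC.
  exact: comul_coef_linear.
exact: sum_zero_linear.
Qed.

(* The component at [s'] of the differential of X times [s] is X times the
   component at [s'] of the differential of [s]. *)
Lemma cube_coef_linear (s s' : resolution * labelling) :
  \sum_(b : bool) cube_coef (s.1, set_base s.1 true s.2)
      (s'.1, set_base s'.1 b s'.2) *: basisA h t b
  = basisA h t true * cube_coefA (s.1, set_base s.1 false s.2) s'.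
Proof.
rewrite /cube_coefA /cube_coef /=.
under eq_bigr do rewrite scaler_suml.
under [in RHS]eq_bigr do rewrite scaler_suml.
rewrite exchange_big [in RHS]exchange_big mulr_sumr; apply: eq_bigr => c.
case/andP => _ /eqP ->.
under eq_bigr do rewrite -scalerA.
under [in RHS]eq_bigr do rewrite -scalerA.
by rewrite -!scaler_sumr edge_coef_linear scalerAr.
Qed.

End Cube.

Section ModX.
Variables (R : comNzRingType) (h : R).
Local Notation A := (frob h 0).

(* The projection of A to A / (X) = R. *)
Definition mod_frobX (a : A) : R := (a : {poly R})`_0.

Fact mod_frobX_is_zmod_morphism : zmod_morphism mod_frobX.
Proof. by move=> a b; rewrite /mod_frobX /= coefB. Qed.

Fact mod_frobX_is_monoid_morphism : monoid_morphism mod_frobX.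
Proof.
split=> [|a b]; first by rewrite /mod_frobX /= coefC.
have abE : (a * b : A) = Pdiv.CommonRing.rmodp ((a : {poly R}) * b)
    (frob_poly h 0) :> {poly R}.
  by rewrite poly_of_qpolyM; congr Pdiv.CommonRing.rmodp; exact: mk_monic_frob.
rewrite /mod_frobX abE -!horner_coef0 -hornerM.
rewrite [in RHS](Pdiv.RingMonic.rdivp_eq (frob_poly_monic h 0) (_ * _)).
rewrite hornerD hornerM [(frob_poly h 0).[0]]horner_coef0 !coefE /=.
by rewrite mulr0 !subr0 mulr0 add0r.
Qed.

HB.instance Definition _ :=
  GRing.isZmodMorphism.Build A R mod_frobX mod_frobX_is_zmod_morphism.
HB.instance Definition _ :=
  GRing.isMonoidMorphism.Build A R mod_frobX mod_frobX_is_monoid_morphism.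

Lemma mod_frobX_surj (r : R) : mod_frobX r%:A = r.
Proof. by rewrite /mod_frobX poly_of_qpolyZ coefZ coefC mulr1. Qed.

Lemma mod_frobX_eq0 (a : A) :
  mod_frobX a = 0 <-> exists b, a = frobX h 0 * b.
Proof.
split=> [a0|[b ->]]; last first.
  rewrite rmorphM /= {1}/mod_frobX /frobX.
  by rewrite qpolyXE ?size_frob_poly ?frob_poly_monic // coefX mul0r.
exists ((a : {poly R})`_1)%:A.
have a0' : (a : {poly R})`_false *: basisA h 0 false = 0.
  by rewrite [_`_false]a0 scale0r.
apply: etrans (frobE a) _; rewrite big_bool a0'.
by apply: etrans (addr0 _) _; rewrite -scalerAr mulr1.
Qed.

End ModX.

Section Invariants.
Implicit Types K : knot_diagram.

Definition bracket K : free_complex {poly int} :=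
  base_change (@mod_frobX _ _) (unreduced K (- 'X) 0).

Definition lambda K : enat :=
  enat_min (fun k => equivalent_up_to ('X ^+ k) (bracket K) (bracket unknot)).

Definition u_G K : enat := max_torsion_order (homology (bracket K)) 'X.

(* Z[alpha_1, alpha_2] is [{poly {poly int}}]. *)
Definition nu K : enat :=
  let alpha1 : {poly {poly int}} := 'X%:P in
  let alpha2 : {poly {poly int}} := 'X in
  let h := alpha1 + alpha2 in let t := - (alpha1 * alpha2) in
  max_torsion_order (homology (unreduced K h t)) (2%:R * frobX h t - h%:A).

Definition u_Xfield (F : fieldType) K : enat :=
  max_torsion_order (homology (unreduced K 0 ('X : {poly F}))) (frobX 0 'X).

Definition u_X K : enat := u_Xfield rat K.

Definition u_Xp (p : nat) K : enat := u_Xfield 'F_p K.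

Definition u_h K : enat :=
  max_torsion_order (homology (unreduced K ('X : {poly 'F_2}) 0)) 'X%:A.

End Invariants.

(* Main.v *)
(* Let x be the class of X in A = R[X]/(X^2 - h X - t), and let A be the ground
   ring of the complex, via the circle of the base point. Since
   Y^2 - h Y - t = (Y - x) (Y - x + (2 x - h)), passing from the basis 1, Y to the
   basis 1, Y - x on each of the remaining circles turns the unreduced complex into
   the base change of the bracket along G |-> 2 x - h. All claims are then about
   such base changes.
   (i) Z[alpha_1, alpha_2][X]/((X - alpha_1) (X - alpha_2)) is free over Z[G], with
   basis the elements alpha_1^i and alpha_1^i (X - alpha_1), and has Z[G] as a
   retract.
   (ii) Q[X] is a localisation of Z[G].
   (iii), (iv) The bracket of the unknot has differential zero and 2 x - h is
   regular in A, so f kills all torsion cycles and the homotopy from g f to G^k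
   shows that G^k does. *)
Require Import Defs.
From HB Require Import structures.
From mathcomp Require Import all_boot all_algebra.
From mathcomp Require Import boolp.
From mathcomp Require Import ring.

Set Implicit Arguments.
Unset Strict Implicit.
Unset Printing Implicit Defensive.

Import GRing.Theory Num.Theory.
Local Open Scope ring_scope.

(** * The basis 1, X - x on every circle *)

Section Labels.
Variables (S : comNzRingType) (h t : S).

Lemma mul_coefE (i j k : bool) :
  mul_coef h t i j k =
  if i && j then (if k then h else t) else (k == i || j)%:R.
Proof.
rewrite /mul_coef /basisA.
have X1 : frobX h t = 'X :> {poly S}.
  by rewrite /frobX qpolyXE ?size_frob_poly ?frob_poly_monic.
have e0 : ((1 : frob h t) : {poly S}) = 1 by [].
have X2 : frobX h t * frobX h t = h *: 'X + t *: 1 :> {poly S}.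
  by rewrite -expr2 frobX_sqr -X1.
case: i j => -[]; rewrite ?expr0 ?expr1 ?mulr1 ?mul1r ?X2 ?X1;
  by case: k; rewrite !coefE /= ?mulr0 ?mulr1 ?add0r ?addr0.
Qed.

End Labels.

Section Substitution.
Variables (S : comNzRingType) (h t : S).

(** Transition matrix from the basis 1, X to the basis 1, X - x: the row of X reads X = (X - x) +
    x. *)
Definition subst_coef (x : S) (i k : bool) : S :=
  if i then (if k then 1 else x) else (~~ k)%:R.

Variable x : S.
Hypothesis x2 : x ^+ 2 = h * x + t.

(** Put Y = X - x. As x is a root, Y^2 = (h - 2 x) Y, so in the basis 1, Y the product has the
    parameters h - 2 x and 0. *)
Lemma subst_mul (i j k : bool) :
  \sum_b mul_coef h t i j b * subst_coef x b k =
  \sum_b \sum_b' subst_coef x i b * subst_coef x j b'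
    * mul_coef (h - x *+ 2) 0 b b' k.
Proof.
have t_ : t = x ^+ 2 - h * x by rewrite x2 addrAC subrr add0r.
rewrite !big_bool /= !mul_coefE t_; case: i j k => -[] [] /=; ring.
Qed.

(** In the basis 1, Y the constant term of Delta(1) becomes -(h - 2 x), and Delta(Y) is the tensor
    square of Y. *)
Lemma subst_comul (i k k' : bool) :
  \sum_b \sum_b' comul_coef h t i b b' * (subst_coef x b k * subst_coef x b' k')
  = \sum_b subst_coef x i b * comul_coef (h - x *+ 2) 0 b k k'.
Proof.
have t_ : t = x ^+ 2 - h * x by rewrite x2 addrAC subrr add0r.
rewrite !big_bool /= t_; case: i k k' => -[] [] /=; ring.
Qed.

Lemma subst_opp (i k : bool) :
  \sum_b subst_coef x i b * subst_coef (- x) b k = (i == k)%:R.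
Proof. rewrite big_bool; case: i k => -[] /=; ring. Qed.

End Substitution.

(** * Labelled circles of a resolution and the basis change on them *)

Section Circles.
Variable D : gauss_code.
Local Notation arc := (Defs.arc D).
Local Notation labelling := (labelling D).
Local Notation resolution := (resolution D).
Implicit Types (v w : resolution) (l m : labelling).

Definition constant_on_circles v l : bool :=
  [forall a, forall a', circle v a a' ==> (l a == l a')].

Lemma constantP v l :
  reflect (forall a a', circle v a a' -> l a = l a') (constant_on_circles v l).
Proof.
apply: (iffP forallP) => [lP a a' aa'|lP a].
  by apply/eqP; move: (lP a) => /forallP/(_ a')/implyP; apply.
by apply/forallP => a'; apply/implyP => /lP ->.
Qed.

Definition circle_root v (a : arc) : arc := fingraph.root (gluing (joins v)) a.

Lemma circle_rootP v a : circle v a (circle_root v a).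
Proof. exact: connect_root. Qed.

Lemma circle_root_eq v a a' : (circle_root v a == circle_root v a') = circle v a a'.
Proof. by rewrite /circle_root root_connect //; apply: circle_sym. Qed.

Lemma circle_root_id v a : circle_root v (circle_root v a) = circle_root v a.
Proof. by apply: root_root; apply: circle_sym. Qed.

Lemma eq_circle_root v w a : circle v a =1 circle w a ->
  circle_root v a = circle_root w a.
Proof. by move=> vw; rewrite /circle_root /fingraph.root; congr odflt;
  apply: eq_pick. Qed.

(** Selects one arc per circle, so that products over circles become products over arcs. *)
Definition circle_repr v : pred arc := fun a => circle_root v a == a.

Lemma root_circle_repr v x a :
  (circle v x a && circle_repr v a) = (a == circle_root v x).
Proof.
apply/andP/eqP => [[xa /eqP <-]|->]; first by apply/eqP;
  rewrite circle_root_eq circle_sym.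
by rewrite /circle_repr circle_root_id eqxx circle_rootP.
Qed.

Variable S : comNzRingType.

(** Entry of the tensor power of [subst_coef x], with one tensor factor per circle. *)
Definition subst_prod v (x : S) l m : S :=
  \prod_(a | circle_repr v a) subst_coef x (l a) (m a).

(** The sum over labellings factors over the circles, and on each circle the shifts by x and by - x
    are inverse. *)
Lemma subst_prod_inv v (x : S) l l' :
    constant_on_circles v l -> constant_on_circles v l' ->
  \sum_(m | constant_on_circles v m)
     subst_prod v x l m * subst_prod v (- x) m l' = (l == l')%:R.
Proof.
move=> /constantP lC /constantP l'C.
have lr m a : (forall a a', circle v a a' -> m a = m a') ->
  m (circle_root v a) = m a.
  by move=> mC; apply/esym/mC/circle_rootP.
pose F (a : arc) (b : bool) := subst_coef x (l a) b * subst_coef (- x) b (l' a).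
transitivity (\prod_(a | circle_repr v a) \sum_b F a b); last first.
  under eq_bigr do rewrite subst_opp.
  have [<-|neq] := eqVneq l l'; first by rewrite big1 // => a _; rewrite eqxx.
  have [a la] : exists a, l a != l' a.
    by apply/existsP; apply: contra_neqT neq => /existsPn ll; apply/ffunP => a;
      apply/eqP/negbNE/ll.
  rewrite (bigD1 (circle_root v a)) /=; last by rewrite /circle_repr circle_root_id.
  by rewrite !lr // (negPf la) mul0r.
(* Expanding the product gives one term per choice of a label on each representative, with default
   [false] on the other arcs; such choices correspond to labellings constant on the circles. *)
rewrite (big_distr_big_dep false).
rewrite (reindex_onto (fun f : labelling => [ffun a => f (circle_root v a)] :
  labelling)
  (fun m : labelling => [ffun a => circle_repr v a && m a])) /=; last first.
  move=> m /constantP mC; apply/ffunP => a;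
    rewrite !ffunE /circle_repr circle_root_id eqxx /=.
  exact: lr.
apply: eq_big => [f|f _].
  apply/andP/pfamilyP => [[_ /eqP fE]|[fs _]].
    split=> //; apply/subsetP => a; rewrite !unfold_in; apply: contraR => na.
    have := congr1 (fun g : labelling => g a) fE.
    by rewrite ffunE [circle_repr v a](negbTE na) /= => <-; rewrite eqxx.
  split; first by apply/constantP => a a';
    rewrite -circle_root_eq !ffunE => /eqP ->.
  apply/eqP/ffunP => a; rewrite !ffunE.
  have [/eqP -> //|na] := boolP (circle_repr v a).
  by apply/esym/negbTE; move: na; apply: contraR; rewrite negbK => fa;
    apply: (subsetP fs); rewrite unfold_in /= eqbF_neg negbK.
rewrite -big_split /=; apply: eq_bigr => a /eqP ra.
by rewrite /F ffunE ra.
Qed.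

(** * Separating the circles through two given arcs from all others *)

Section TwoPoints.
Variables (u : resolution) (x y : arc).

Definition far (a : arc) : bool := ~~ circle u x a && ~~ circle u y a.

Lemma far_circle a a' : circle u a a' -> far a = far a'.
Proof.
move=> aa'; rewrite /far; congr (~~ _ && ~~ _); apply/idP/idP => xa;
  by [exact: connect_trans xa aa' | apply: connect_trans xa _;
    rewrite -/(circle u _ _) circle_sym].
Qed.

Lemma prod_near (F : arc -> S) :
  \prod_(a | circle_repr u a && ~~ far a) F a =
  F (circle_root u x) * (if circle u x y then 1 else F (circle_root u y)).
Proof.
have nearE a : circle_repr u a && ~~ far a =
    (a == circle_root u x) || (a == circle_root u y).
  by rewrite -!root_circle_repr -andb_orl andbC /far negb_and !negbK.
under eq_bigl do rewrite nearE.
case: ifP => xy.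
  have /eqP <- : circle_root u x == circle_root u y by rewrite circle_root_eq.
  by under eq_bigl do rewrite orbb; rewrite big_pred1_eq mulr1.
rewrite (bigD1 (circle_root u x)) ?eqxx //=; congr (_ * _).
apply: big_pred1 => a; have [->|] := eqVneq a (circle_root u x);
  last by rewrite andbT.
by rewrite andbF /= circle_root_eq xy.
Qed.

Lemma subst_prod_near z l m :
    constant_on_circles u l -> constant_on_circles u m ->
  subst_prod u z l m =
    (\prod_(a | circle_repr u a && far a) subst_coef z (l a) (m a)) *
    (subst_coef z (l x) (m x) *
     (if circle u x y then 1 else subst_coef z (l y) (m y))).
Proof.
move=> /constantP lC /constantP mC; rewrite /subst_prod (bigID far) /= prod_near.
by rewrite -!(lC _ _ (circle_rootP u _)) -!(mC _ _ (circle_rootP u _)).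
Qed.

(** A labelling prescribed on the far circles is determined by its labels at [x] and [y], which are
    free unless the two arcs share a circle. *)
Lemma sum_near (l0 : labelling) (G : bool -> bool -> S) :
    (forall a a', circle u a a' -> far a -> l0 a = l0 a') ->
  \sum_(m | constant_on_circles u m)
     (if [forall a, far a ==> (l0 a == m a)] then G (m x) (m y) else 0) =
  \sum_b (if circle u x y then G b b else \sum_b' G b b').
Proof.
move=> l0C; rewrite -big_mkcondr /=.
pose ext b b' : labelling :=
  [ffun a => if circle u x a then b else if circle u y a then b' else l0 a].
have extP m b b' : (circle u x y -> b = b') ->
    (constant_on_circles u m && [forall a, far a ==> (l0 a == m a)])
      && ((m x == b) && (m y == b')) = (m == ext b b').
  move=> bb'; apply/idP/eqP => [/andP[/andP[/constantP mC /forallP mF]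
    /andP[/eqP mx /eqP my]]|->].
    apply/ffunP => a; rewrite ffunE.
    have [xa|nxa] := boolP (circle u x a); first by rewrite -(mC _ _ xa).
    have [ya|nya] := boolP (circle u y a); first by rewrite -(mC _ _ ya).
    by move: (mF a) => /implyP; rewrite /far nxa nya => /(_ isT)/eqP.
  rewrite !ffunE !circle_refl !eqxx /=; apply/andP; split; last first.
    by case: ifP => // /bb' ->.
  apply/andP; split; last first.
    apply/forallP => a; apply/implyP => /andP[/negPf nx /negPf ny].
    by rewrite ffunE nx ny.
  apply/constantP => a a' aa'; rewrite !ffunE.
  have E z : circle u z a = circle u z a'.
    apply/idP/idP => za; first exact: connect_trans za aa'.
    by apply: connect_trans za _; rewrite -/(circle u _ _) circle_sym.
  rewrite !E; case: ifP => // nx; case: ifP => // ny.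
  by apply: l0C => //; rewrite (far_circle aa') /far nx ny.
rewrite (partition_big (fun m : labelling => m x) predT) //=; apply: eq_bigr => b _.
case: ifP => xy.
  rewrite (big_pred1 (ext b b)) /=; first by rewrite !ffunE !circle_refl xy.
  move=> m; rewrite /= -extP //; apply: andb_id2l => /andP[/constantP mC _].
  by rewrite -(mC _ _ xy) andbb.
rewrite (partition_big (fun m : labelling => m y) predT) //=;
  apply: eq_bigr => b' _.
rewrite (big_pred1 (ext b b')) /=; last by move=> m; rewrite -andbA extP // xy.
by rewrite !ffunE !circle_refl xy.
Qed.

End TwoPoints.

(** * Edge maps of the cube in the new basis *)

Section Edge.
Variables (h t z : S).
Hypothesis z2 : z ^+ 2 = h * z + t.

Lemma far_raise v c a (x := arc_in c true) (y := arc_out c true) :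
  far (raise v c) x y a = far v x y a.
Proof.
apply/idP/idP => [|/andP[nx ny]].
  by rewrite /far -!negb_or; apply: contra; apply: circle_raise_near.
have E := circle_raise_far _ erefl nx ny.
by rewrite /far circle_sym -E circle_sym nx circle_sym -E circle_sym.
Qed.

(** The circles away from the crossing agree in [v] and [w] and contribute the same product to both
    sides. What remains is [subst_mul] for a merge and [subst_comul] for a split. *)
Lemma edge_coef_subst v c l l' (w := raise v c) :
    constant_on_circles v l -> constant_on_circles w l' ->
  \sum_(m | constant_on_circles w m)
     edge_coef h t v c l m * subst_prod w z m l' =
  \sum_(m | constant_on_circles v m)
     subst_prod v z l m * edge_coef (h - z *+ 2) 0 v c m l'.
Proof.
move=> lC l'C; pose x := arc_in c true; pose y := arc_out c true.
have farE : far w x y =1 far v x y by move=> a; apply: far_raise.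
(* The factor of [edge_coef] that depends only on the labels at [x] and [y], before and after the
   edge. *)
pose loc h t i j k k' : S :=
  if ~~ circle v x y && circle w x y then mul_coef h t i j k
  else if circle v x y && ~~ circle w x y then comul_coef h t i k k' else 0.
pose near u l m := subst_coef z (l x) (m x) *
  (if circle u x y then 1 else subst_coef z (l y) (m y)).
pose P := \prod_(a | circle_repr v a && far v x y a) subst_coef z (l a) (l' a).
have PE : \prod_(a | circle_repr w a && far w x y a) subst_coef z (l a) (l' a) = P.
  apply: eq_bigl => a; rewrite farE andbC [RHS]andbC;
    apply: andb_id2l => /andP[nx ny].
  by rewrite /circle_repr (@eq_circle_root v w) // => a';
    apply: (circle_raise_far _ erefl).
pose G1 b b' := P * (loc h t (l x) (l y) b b' *
  (subst_coef z b (l' x) * (if circle w x y then 1 else subst_coef z b' (l' y)))).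
pose G2 b b' := P * ((subst_coef z (l x) b *
  (if circle v x y then 1 else subst_coef z (l y) b'))
  * loc (h - z *+ 2) 0 b b' (l' x) (l' y)).
transitivity (\sum_(m | constant_on_circles w m)
   (if [forall a, far w x y a ==> (l a == m a)] then G1 (m x) (m y) else 0)).
  apply: eq_bigr => m mC; rewrite /edge_coef -/w -/x -/y.
  have -> : [forall a, ~~ circle v x a && ~~ circle v y a ==> (l a == m a)] =
      [forall a, far w x y a ==> (l a == m a)].
    by apply: eq_forallb => a; rewrite farE.
  case: ifP => [/forallP lm|_]; last by rewrite mul0r.
  rewrite -/(loc h t (l x) (l y) (m x) (m y)) (subst_prod_near x y) // /G1 -PE
    mulrCA.
  congr (_ * _); apply: eq_bigr => a /andP[_ fa].
  by move: (lm a); rewrite fa => /eqP ->.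
transitivity (\sum_(m | constant_on_circles v m)
   (if [forall a, far v x y a ==> (l' a == m a)] then G2 (m x) (m y) else 0));
     last first.
  apply: eq_bigr => m mC; rewrite /edge_coef -/w -/x -/y.
  have -> : [forall a, ~~ circle v x a && ~~ circle v y a ==> (m a == l' a)] =
      [forall a, far v x y a ==> (l' a == m a)].
    by apply: eq_forallb => a; rewrite [l' a == _]eq_sym.
  case: ifP => [/forallP lm|_]; last by rewrite mulr0.
  rewrite -/(loc _ _ (m x) (m y) (l' x) (l' y)) (subst_prod_near x y) // /G2
    -[RHS]mulrA.
  rewrite -mulrA; congr (_ * _); apply: eq_bigr => a /andP[_ fa].
  by move: (lm a); rewrite fa => /eqP ->.
rewrite !sum_near; first last.
- move=> a a' aa' fa; move/constantP: lC; apply.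
  by move: fa; rewrite farE => /andP[nx ny];
    rewrite (circle_raise_far _ erefl nx ny).
- move=> a a' aa' /andP[nx ny]; move/constantP: l'C; apply.
  by rewrite /w -(circle_raise_far _ erefl nx ny).
(* In order: joined in both resolutions (zero map), split, merge, joined in neither (zero map). *)
rewrite /G1 /G2 /loc; case: (circle v x y) (circle w x y) => -[] /=.
- by apply: eq_bigr => b _; rewrite mul0r !mulr0.
- under eq_bigr do rewrite -mulr_sumr; rewrite -!mulr_sumr subst_comul //.
  by congr (_ * _); apply: eq_bigr => b _; rewrite mulr1.
- under eq_bigr do rewrite mulr1.
  under [in RHS]eq_bigr do rewrite -mulr_sumr.
  by rewrite -!mulr_sumr subst_mul.
- by rewrite !big1 // => b _; rewrite big1 // => b' _; rewrite ?mul0r !mulr0.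
Qed.

End Edge.

(** Towards the label 1 the basis change on the base circle has the entries 1 and z, that is
    [z ^+ b]: it evaluates the X of the base circle at z. This is how the A-valued coefficients of
    the unreduced complex arise. *)
Lemma sum_subst_base w z (F : labelling -> S) l' :
    constant_on_circles w l' -> ~~ l' ord0 ->
  \sum_(m | constant_on_circles w m) F m * subst_prod w z m l' =
  \sum_(m | constant_on_circles w m && ~~ m ord0)
     (\sum_b F (set_base w b m) * z ^+ b) * subst_prod w z m l'.
Proof.
move=> l'C /negbTE l'0.
have setC b m : constant_on_circles w m -> constant_on_circles w (set_base w b m).
  move=> /constantP mC; apply/constantP => a a' aa'; rewrite !ffunE (mC _ _ aa').
  suff -> : circle w ord0 a = circle w ord0 a' by [].
  apply/idP/idP => oa; first exact: circle_trans oa aa'.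
  by apply: circle_trans oa _; rewrite circle_sym.
have set0 b m : set_base w b m ord0 = b by rewrite ffunE circle_refl.
have setK m b b' : constant_on_circles w m -> m ord0 = b ->
  set_base w b (set_base w b' m) = m.
  move=> /constantP mC m0; apply/ffunP => a; rewrite !ffunE;
    have [oa|noa] := boolP (circle w ord0 a).
    by rewrite -m0; apply: mC.
  by [].

under [in RHS]eq_bigr do rewrite mulr_suml; rewrite [RHS]exchange_big /=.
(* Sort the labellings by their base label [b], then reset that label to 1. *)
rewrite (partition_big (fun m : labelling => m ord0) predT) //=;
  apply: eq_bigr => b _.
rewrite (reindex_onto (set_base w b) (set_base w false)) /=; last first.
  by move=> m /andP[mC /eqP m0]; apply: setK.
apply: eq_big => [m|m /andP[/andP[mC0 _] /eqP mE]].
  rewrite set0 eqxx andbT; apply/andP/andP => [[mC /eqP mE]|[mC /negbTE m0]].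
    split; last by rewrite -mE set0.
    by rewrite -mE; apply: setC.
  by split; [apply: setC|apply/eqP/setK].
have mC : constant_on_circles w m by rewrite -mE; apply: setC.
have m0 : m ord0 = false by rewrite -mE set0.
rewrite -mulrA; congr (_ * _).
(* With both points at [ord0] the near factor is that of the base circle alone. *)
rewrite !(@subst_prod_near w ord0 ord0) // circle_refl !mulr1 l'0 set0 m0
  [RHS]mulrCA.
congr (_ * _); last by case: (b);
  rewrite /subst_coef /= ?expr0 ?expr1 ?mul1r ?mulr1.
by apply: eq_bigr => a /andP[_ /andP[/negbTE na _]]; rewrite ffunE na.
Qed.

(** The basis change fixes the element 1, so from base label 1 every entry at base label X
    vanishes. *)
Lemma sum_subst_state v z (F : labelling -> S) l :
    constant_on_circles v l -> ~~ l ord0 ->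
  \sum_(m | constant_on_circles v m) subst_prod v z l m * F m =
  \sum_(m | constant_on_circles v m && ~~ m ord0) subst_prod v z l m * F m.
Proof.
move=> lC /negbTE l0; rewrite [LHS](bigID (fun m : labelling => ~~ m ord0)) /=.
rewrite [X in _ + X]big1 ?addr0 // => m /andP[mC /negPn m0].
by rewrite (@subst_prod_near v ord0 ord0) // l0 m0 mul0r mulr0 mul0r.
Qed.

(** Signs and edges do not depend on the basis, so the identity holds edge by edge. *)
Lemma cube_coef_subst (h t z : S) (s s' : resolution * labelling) :
    z ^+ 2 = h * z + t ->
    constant_on_circles s.1 s.2 -> constant_on_circles s'.1 s'.2 ->
  \sum_(m | constant_on_circles s'.1 m)
     cube_coef h t s (s'.1, m) * subst_prod s'.1 z m s'.2 =
  \sum_(m | constant_on_circles s.1 m)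
     subst_prod s.1 z s.2 m * cube_coef (h - z *+ 2) 0 (s.1, m) s'.
Proof.
case: s s' => v l [w l'] /= z2 lC l'C; rewrite /cube_coef /=.
under eq_bigr do rewrite mulr_suml; under [in RHS]eq_bigr do rewrite mulr_sumr.
rewrite exchange_big [RHS]exchange_big /=; apply: eq_bigr => c /andP[_ /eqP wE].
under eq_bigr do rewrite -mulrA; under [in RHS]eq_bigr do rewrite mulrCA.
rewrite wE in l'C *; rewrite -[LHS]mulr_sumr -[RHS]mulr_sumr; congr (_ * _).
exact: edge_coef_subst.
Qed.

(* The change of the basis 1, X of each factor to 1, X - z; on the factor of the
   base circle nothing changes. *)
Definition subst_mx (z : S) : 'M[S]_#|states D| :=
  \matrix_(i, j) (((enum_val i).1 == (enum_val j).1)%:R *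
     subst_prod (enum_val i).1 z (enum_val i).2 (enum_val j).2).

Lemma sum_states (F : resolution * labelling -> S) w :
  \sum_(i < #|states D|) ((enum_val i).1 == w)%:R * F (enum_val i) =
  \sum_(m | constant_on_circles w m && ~~ m ord0) F (w, m).
Proof.
rewrite -(big_enum_val (fun s => (s.1 == w)%:R * F s)) /=.
transitivity (\sum_(s in states D | s.1 == w) F s).
  by rewrite big_mkcondr; apply: eq_bigr => s _; case: eqP; rewrite ?mul1r ?mul0r.
rewrite (reindex_onto (fun m : labelling => (w, m)) snd) /=; last first.
  by case=> v m /andP[_ /= /eqP ->].
by apply: eq_bigl => m; rewrite inE /= !eqxx !andbT.
Qed.

Lemma stateP (i : 'I_#|states D|) :
  constant_on_circles (enum_val i).1 (enum_val i).2 /\ ~~ (enum_val i).2 ord0.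
Proof. by apply/andP; have := enum_valP i; rewrite inE. Qed.

Lemma subst_mxK z : subst_mx z *m subst_mx (- z) = 1%:M.
Proof.
apply/matrixP => i j; rewrite !mxE.
have [[iC i0] [jC j0]] := (stateP i, stateP j).
under eq_bigr do rewrite !mxE [(enum_val i).1 == _]eq_sym -mulrA.
rewrite (sum_states (fun s => subst_prod _ z _ s.2 * ((s.1 == (enum_val j).1)%:R *
   subst_prod s.1 (- z) s.2 (enum_val j).2))) /=.
(* Enlarge the sum from states to all labellings constant on the circles, where [subst_prod_inv]
   applies. *)
rewrite -(sum_subst_state _ (fun m => _)) //.
have [ij|nij] := eqVneq (enum_val i).1 (enum_val j).1; last first.
  rewrite big1 => [|m _]; last by rewrite mul0r mulr0.
  by have [eij|] := eqVneq i j; first by rewrite eij eqxx in nij.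
under eq_bigr do rewrite mul1r; rewrite subst_prod_inv //; last by rewrite ij.
congr (nat_of_bool _)%:R; apply/eqP/eqP => [ll|-> //].
by apply: enum_val_inj; rewrite [LHS]surjective_pairing ij ll -surjective_pairing.
Qed.

(** The identity [cube_coef_subst] restricted to states: [sum_subst_base] absorbs the base circle on
    the left, and [sum_subst_state] discards the base label X on the right. *)
Lemma cube_mx_subst (h t z : S) : z ^+ 2 = h * z + t ->
  (\matrix_(i < #|states D|, j < #|states D|) (\sum_b cube_coef h t (enum_val i)
      ((enum_val j).1, set_base (enum_val j).1 b (enum_val j).2) * z ^+ b))
    *m subst_mx z =
  subst_mx z *m
    \matrix_(i, j) (cube_coef (h - z *+ 2) 0 (enum_val i) (enum_val j)).
Proof.
move=> z2; apply/matrixP => i j; rewrite !mxE.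
have [[iC i0] [jC j0]] := (stateP i, stateP j).
under eq_bigr do rewrite !mxE mulrCA.
under [in RHS]eq_bigr do rewrite !mxE [(enum_val i).1 == _]eq_sym -mulrA.
rewrite (sum_states (fun s => (\sum_b cube_coef h t _ (s.1, set_base s.1 b s.2)
  * _) *
  subst_prod s.1 z s.2 _)) /=.
rewrite (sum_states (fun s => subst_prod _ z _ s.2 * cube_coef _ _ s _)) /=.
rewrite -(sum_subst_state _ (fun m => _)) // -(cube_coef_subst z2) //.
by rewrite (sum_subst_base _ (fun m => _)).
Qed.

End Circles.

(** * Structure constants under ring homomorphisms *)

Section Naturality.
Variables (R S : comNzRingType) (phi : {rmorphism R -> S}) (h t : R).

Lemma mul_coef_rmorph (i j k : bool) :
  mul_coef (phi h) (phi t) i j k = phi (mul_coef h t i j k).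
Proof. by rewrite !mul_coefE !(fun_if phi) rmorph_nat. Qed.

Lemma comul_coef_rmorph (i j k : bool) :
  comul_coef (phi h) (phi t) i j k = phi (comul_coef h t i j k).
Proof. by case: i j k => -[] []; rewrite /= ?rmorphN ?rmorph0 ?rmorph1. Qed.

Lemma cube_coef_rmorph (D : gauss_code) (s s' : resolution D * labelling D) :
  cube_coef (phi h) (phi t) s s' = phi (cube_coef h t s s').
Proof.
rewrite /cube_coef rmorph_sum; apply: eq_bigr => c _.
rewrite rmorphM rmorph_sign /=; congr (_ * _).
by rewrite /edge_coef mul_coef_rmorph comul_coef_rmorph !(fun_if phi) rmorph0.
Qed.

End Naturality.

(** * The unreduced complex as a base change of the bracket *)

Section UnreducedFromBracket.
Variables (R : comNzRingType) (h t : R) (K : knot_diagram).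
Local Notation A := (frob h t).
Local Notation x := (frobX h t : A).
Variable phi : {rmorphism {poly int} -> A}.
Hypothesis phiG : phi 'X = 2%:R * x - h%:A.

(** Modulo X only the summand with base label 1 survives, and a state already has that base
    label. *)
Lemma bracket_mxE :
  diff_mx (bracket K) = \matrix_(i < #|states K|, j < #|states K|)
    (cube_coef (- 'X) 0 (enum_val i) (enum_val j) : {poly int}).
Proof.
apply/matrixP => i j; rewrite !mxE /cube_coefA rmorph_sum big_bool /=.
have modZ (c : {poly int}) (b : bool) :
    mod_frobX (c *: basisA (- 'X) 0 b : frob (- 'X : {poly int}) 0) = c * (~~ b)%:R.
  rewrite -[in LHS]mulr_algl rmorphM /= mod_frobX_surj; congr (_ * _).
  case: b; rewrite /basisA ?expr0 ?expr1 ?rmorph1 //=.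
  by apply/mod_frobX_eq0; exists 1; rewrite mulr1.
rewrite !modZ mulr0 mulr1 add0r; congr cube_coef.
have [/constantP jC j0] := stateP j; rewrite [RHS]surjective_pairing; congr (_, _).
apply/ffunP => a; rewrite ffunE; case: ifP => // oa.
by rewrite -(jC _ _ oa) (negbTE j0).
Qed.

Lemma unreduced_mxE :
  diff_mx (unreduced K h t) = \matrix_(i < #|states K|, j < #|states K|)
    (\sum_b cube_coef h%:A t%:A (enum_val i)
      ((enum_val j).1, set_base (enum_val j).1 b (enum_val j).2) * x ^+ b).
Proof.
apply/matrixP => i j; rewrite !mxE /cube_coefA; apply: eq_bigr => b _.
by rewrite (cube_coef_rmorph (GRing.in_alg A)) /= mulr_algl.
Qed.

(** Apply [cube_mx_subst] over A with z = x, the class of X; the new parameter h - 2 x is the image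
    of -G. *)
Lemma unreduced_bracket :
  diff_mx (unreduced K h t) *m subst_mx K x =
  subst_mx K x *m map_mx phi (diff_mx (bracket K)).
Proof.
rewrite unreduced_mxE bracket_mxE cube_mx_subst; last first.
  by rewrite frobX_sqr mulr_algl.
congr (_ *m _); apply/matrixP => i j; rewrite !mxE.
by rewrite -cube_coef_rmorph rmorph0 rmorphN phiG opprB mulr_natl.
Qed.

End UnreducedFromBracket.

(** * Torsion bounds and base change *)

Lemma enat_le_min (P Q : nat -> Prop) :
  (forall n, Q n -> P n) -> enat_le (enat_min P) (enat_min Q).
Proof.
move=> QP; case QE: (enat_min Q) => [n|]; last by case: (enat_min P).
have /enat_minP[/QP Pn _] := QE.
case PE: (enat_min P) => [m|]; first by have /enat_minP[_] := PE; apply.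
move: PE; rewrite /enat_min; case: pselect => // noP _.
by case: noP; exists n; apply/asboolP.
Qed.

Section TorsionBound.
Variables (B : comNzRingType).

(** That [r ^+ N] kills all [r]-torsion in homology, phrased with matrices so that conjugation and
    base change act directly. *)
Definition torsion_bound n (M : 'M[B]_n) (r : B) (N : nat) : Prop :=
  forall (u : 'rV_n) k, u *m M = 0 ->
    (exists w : 'rV_n, r ^+ k *: u = w *m M) ->
    exists w : 'rV_n, r ^+ N *: u = w *m M.

Lemma max_torsion_orderE (C : free_complex B) (r : B) :
  max_torsion_order (homology C) r = enat_min (torsion_bound (diff_mx C) r).
Proof.
rewrite /max_torsion_order; congr enat_min; apply/funext => N; apply/propext.
have zeroP (z : Defs.cycle C) k :
    r ^+ k *: homology_class z = 0 <-> exists w :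
      'rV_(rank C), r ^+ k *: val z = w *m diff_mx C.
  rewrite -homology_classZ; have -> : 0 = homology_class (0 : Defs.cycle C).
    by rewrite -(scale0r (0 : Defs.cycle C)) homology_classZ scale0r.
  split=> [/eqP/homology_class_eqP[w]|[w wE]]; first by rewrite subr0 linearZ;
    exists w.
  by apply/eqP/homology_class_eqP; exists w; rewrite subr0 linearZ.
split=> [ordN u k u0 [w wE]|bndN a k /enat_minP[ak mink]].
  have uC : u \in @is_cycle _ C by rewrite unfold_in; apply/eqP.
  pose z : Defs.cycle C := Cycle uC.
  have zk : r ^+ k *: homology_class z = 0 by apply/zeroP; exists w.
  case ordE: (torsion_order r (homology_class z)) => [m|]; last first.
    move: ordE; rewrite /torsion_order /enat_min; case: pselect => // noP _.
    by case: noP; exists k; apply/asboolP.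
  have mN := ordN _ _ ordE; move/enat_minP: ordE => [zm _].
  by apply/(zeroP z); rewrite -(subnK mN) exprD -scalerA zm scaler0.
apply: mink; rewrite -(homology_classK a); apply/zeroP.
have aC : val (repr a) *m diff_mx C = 0 by have := valP (repr a);
  rewrite unfold_in => /eqP.
by apply: (bndN _ k aC); apply/zeroP; rewrite homology_classK.
Qed.

(** [P] is an isomorphism of complexes, since a one-sided inverse of a square matrix is
    two-sided. *)
Lemma torsion_bound_conj n (M M' P Q : 'M[B]_n) r N :
    M *m P = P *m M' -> P *m Q = 1%:M ->
  torsion_bound M r N <-> torsion_bound M' r N.
Proof.
move=> MP PQ; have QP : Q *m P = 1%:M by apply: mulmx1C.
have QM : M' *m Q = Q *m M.
  by rewrite -[M']mul1mx -QP -(mulmxA Q) -MP -!mulmxA PQ mulmx1.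
have aux (X Y U V : 'M[B]_n) : X *m U = U *m Y -> Y *m V = V *m X ->
  U *m V = 1%:M ->
    torsion_bound Y r N -> torsion_bound X r N.
  move=> XU YV UV bY u k u0 [w wE].
  have [||w' w'E] := bY (u *m U) k.
  - by rewrite -mulmxA -XU mulmxA u0 mul0mx.
  - by exists (w *m U); rewrite scalemxAl wE -!mulmxA XU.
  exists (w' *m V); rewrite -mulmxA -YV mulmxA -w'E -!scalemxAl -mulmxA UV.
  by rewrite mulmx1.
by split; [apply: aux QM MP QP | apply: aux MP QM PQ].
Qed.

(** Serves to replace 2 x by x where 2 is invertible, and -h by h. *)
Lemma torsion_bound_unit n (M : 'M[B]_n) (c c' r : B) N :
  c' * c = 1 -> torsion_bound M (c * r) N -> torsion_bound M r N.
Proof.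
move=> c1 b u k u0 [w wE]; have [|w' w'E] := b u k u0.
  by exists (c ^+ k *: w); rewrite exprMn -scalerA wE scalemxAl.
exists (c' ^+ N *: w'); rewrite -scalemxAl -w'E exprMn scalerA mulrA -exprMn.
by rewrite c1 expr1n mul1r.
Qed.

End TorsionBound.

(** * Transfer of torsion bounds along ring homomorphisms *)

Section BaseChange.
Variables (B S : comNzRingType) (f : {rmorphism B -> S}).

(** A bounding chain found over [S] is brought back to [B] by the retraction [g]. *)
Lemma torsion_bound_retract (g : {rmorphism S -> B}) n (M : 'M[B]_n) r N :
  cancel f g -> torsion_bound (map_mx f M) (f r) N -> torsion_bound M r N.
Proof.
move=> fK b u k u0 [w wE]; have [||w' w'E] := b (map_mx f u) k.
- by rewrite -map_mxM u0 map_mx0.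
- by exists (map_mx f w); rewrite -map_mxM -wE map_mxZ rmorphXn.
have mK p q (X : 'M[B]_(p, q)) : map_mx g (map_mx f X) = X.
  by apply/matrixP => i j; rewrite !mxE fK.
exists (map_mx g w'); rewrite -[M]mK -map_mxM -w'E map_mxZ mK.
by rewrite rmorphXn /= fK.
Qed.

(** The [p i] are [B]-linear coordinates with respect to the [e i]. The coordinates of a torsion
    cycle are torsion cycles over [B], and their bounding chains reassemble to one over [S]. *)
Lemma torsion_bound_free (p : nat -> {additive S -> B}) (e : nat -> S) n (M :
  'M[B]_n) r N :
    (forall i b a, p i (f b * a) = b * p i a) ->
    (forall a, exists m, forall m', (m <= m')%N ->
      a = \sum_(i < m') f (p i a) * e i) ->
  torsion_bound M r N -> torsion_bound (map_mx f M) (f r) N.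
Proof.
move=> pM pE b u k u0 [w wE].
have pMx i (y : 'rV[S]_n) : map_mx (p i) (y *m map_mx f M) = map_mx (p i) y *m M.
  apply/matrixP => a c; rewrite !mxE raddf_sum; apply: eq_bigr => j _.
  by rewrite !mxE mulrC pM mulrC.
have pZ i l (y : 'rV[S]_n) :
  map_mx (p i) (f r ^+ l *: y) = r ^+ l *: map_mx (p i) y.
  by apply/matrixP => a c; rewrite !mxE -rmorphXn pM.
have : forall i, exists y : 'rV_n, r ^+ N *: map_mx (p i) u = y *m M.
  move=> i; apply: (b _ k); first by rewrite -pMx u0 map_mx0.
  by exists (map_mx (p i) w); rewrite -pMx -wE pZ.
move/choice => [y yE].
have [m mE] : exists m, u = \sum_(i < m) e i *: map_mx f (map_mx (p i) u).
  have /choice[m mE] := fun j : 'I_n => pE (u 0 j).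
  (* One truncation length valid for all entries of [u]. *)
  exists (\max_j m j)%N; apply/matrixP => i j; rewrite ord1 summxE.
  rewrite [LHS](mE j (\max_j m j)%N) ?leq_bigmax //; apply: eq_bigr => l _.
  by rewrite !mxE mulrC.
exists (\sum_(i < m) e i *: map_mx f (y i)).
rewrite mulmx_suml {1}mE scaler_sumr; apply: eq_bigr => i _.
by rewrite -scalemxAl -map_mxM -yE map_mxZ rmorphXn !scalerA mulrC.
Qed.

(** The element [a] is the quotient of [f b] by [f c], where [c'] is the inverse of [f c]. *)
Definition is_fraction (a : S) : Prop :=
  exists (c b : B) (c' : S), c' * f c = 1 /\ f c * a = f b.

Lemma fractionM a b : is_fraction a -> is_fraction b -> is_fraction (a * b).
Proof.
move=> [c [p [c' [c1 ca]]]] [d [q [d' [d1 db]]]];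
  exists (c * d), (p * q), (c' * d').
by rewrite !rmorphM mulrACA c1 d1 mulr1 mulrACA ca db.
Qed.

Lemma fractionD a b : is_fraction a -> is_fraction b -> is_fraction (a + b).
Proof.
move=> [c [p [c' [c1 ca]]]] [d [q [d' [d1 db]]]].
exists (c * d), (d * p + c * q), (c' * d'); split.
  by rewrite rmorphM mulrACA c1 d1 mulr1.
by rewrite rmorphD !rmorphM -ca -db; ring.
Qed.

(** Clear the denominators of the cycle and of its bounding chain; injectivity of [f] moves the
    equations to [B], and the denominators are divided out at the end. *)
Lemma torsion_bound_fraction n (M : 'M[B]_n) r N :
    injective f ->
    (forall a, is_fraction a) ->
  torsion_bound M r N -> torsion_bound (map_mx f M) (f r) N.
Proof.
move=> fI fracP b u k u0 [w wE].
have clear (y : 'rV[S]_n) : exists (c : B) (z : 'rV[B]_n) (c' : S),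
    c' * f c = 1 /\ f c *: y = map_mx f z.
  have /choice[c /choice[z /choice[c' cP]]] := fun j => fracP (y 0 j).
  (* The common denominator is the product of those of the entries. *)
  exists (\prod_j c j), (\row_j ((\prod_(i | i != j) c i) * z j)), (\prod_j c' j).
  rewrite rmorph_prod -big_split /=; split.
    by rewrite big1 // => j _; case: (cP j).
  apply/matrixP => i j; rewrite ord1 !mxE (bigD1 j) //= mulrAC rmorphM rmorph_prod.
  by rewrite mulrC; case: (cP j) => _ ->.
have [c [z [c' [c1 zE]]]] := clear u; have [d [y [d' [d1 yE]]]] := clear w.
have mI (X Y : 'rV[B]_n) : map_mx f X = map_mx f Y -> X = Y.
  by move=> /matrixP XY; apply/matrixP => i j; apply: fI; have := XY i j;
    rewrite !mxE.
have [||w' w'E] := b (d *: z) k.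
- by apply: mI; rewrite map_mxM map_mxZ -zE -!scalemxAl u0 !scaler0 map_mx0.
- exists (c *: y); apply: mI; rewrite map_mxM !map_mxZ -zE -yE rmorphXn.
  rewrite -!scalemxAl -wE !scalerA; congr (_ *: _); ring.
exists ((d' * c') *: map_mx f w');
  rewrite -scalemxAl -map_mxM -w'E !map_mxZ -zE rmorphXn.
rewrite !scalerA; congr (_ *: _).
have -> : d' * c' * f r ^+ N * f d * f c = (d' * f d) * (c' * f c) * f r ^+ N
  by ring.
by rewrite c1 d1 !mul1r.
Qed.

(** On row vectors [F] kills boundaries, hence by regularity also torsion cycles. For such a cycle u
    the homotopy then gives r^N u = -(u H) M over [S]. *)
Lemma torsion_bound_homotopy m n (M H : 'M[B]_m) (F : 'M_(m, n)) (G :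
  'M_(n, m)) r N :
    M *m F = 0 -> F *m G - (r ^+ N)%:M = H *m M + M *m H -> GRing.lreg (f r) ->
  torsion_bound (map_mx f M) (f r) N.
Proof.
move=> MF FG regr u k u0 [w wE].
have regk l : injective ( *%R (f r ^+ l)) by exact: lregX.
have uF : u *m map_mx f F = 0.
  apply/matrixP => i j; apply: (regk k); rewrite [in RHS]mxE mulr0.
  transitivity ((f r ^+ k *: (u *m map_mx f F)) i j); first by rewrite !mxE.
  by rewrite scalemxAl wE -mulmxA -map_mxM MF map_mx0 mulmx0 mxE.
exists (- (u *m map_mx f H)); rewrite mulNmx; apply/eqP;
  rewrite -addr_eq0 addrC; apply/eqP.
have /(congr1 (fun X => u *m map_mx f X)) := FG.
rewrite map_mxB map_mxD !map_mxM !mulmxDr !mulmxA uF u0 !mul0mx addr0 mulmxN.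
by rewrite add0r map_scalar_mx rmorphXn mul_mx_scalar => <-; rewrite addNr.
Qed.

End BaseChange.

Lemma torsion_bound_retract_comp (B S T : comNzRingType) (e : {rmorphism B -> S})
    (d : {rmorphism B -> T}) (f : {rmorphism S -> T}) (g : {rmorphism T -> S})
    n (M : 'M[B]_n) r N :
    f \o e =1 d -> cancel f g ->
  torsion_bound (map_mx d M) (d r) N -> torsion_bound (map_mx e M) (e r) N.
Proof.
move=> fe fK; have -> : map_mx d M = map_mx f (map_mx e M).
  by apply/matrixP => i j; rewrite !mxE -fe.
by rewrite -fe; apply: torsion_bound_retract fK.
Qed.

Lemma poly_evaluation (R S : comNzRingType) (phi : {rmorphism R -> S}) (s : S) :
  exists F : {rmorphism {poly R} -> S}, (forall c, F c%:P = phi c) /\ F 'X = s.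
Proof.
have com : commr_rmorph phi s by move=> a; apply: mulrC.
by exists (horner_morph com); split=> [c|];
  [exact: horner_morphC|exact: horner_morphX].
Qed.

Lemma poly_rmorph_ext (R : nzRingType) (S : nzRingType) (F G :
  {rmorphism {poly R} -> S}) :
  (forall c, F c%:P = G c%:P) -> F 'X = G 'X -> F =1 G.
Proof.
move=> FGc FGX; elim/poly_ind => [|p c IHp]; first by rewrite !rmorph0.
by rewrite !rmorphD !rmorphM IHp FGc FGX.
Qed.

Lemma quadratic_mul (S : comNzRingType) (h t x c d c' d' : S) :
  x ^+ 2 = h * x + t ->
  (c + d * x) * (c' + d' * x) =
  (c * c' + d * d' * t) + (c * d' + d * c' + d * d' * h) * x.
Proof.
move=> x2; transitivity (c * c' + (c * d' + d * c') * x + d * d' * x ^+ 2);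
  first by ring.
by rewrite x2; ring.
Qed.

(** * Homomorphisms out of a Frobenius algebra *)

Section FrobLift.
Variables (R S : comNzRingType) (phi : {rmorphism R -> S}) (h t : R) (s : S).
Hypothesis s2 : s ^+ 2 = phi h * s + phi t.
Local Notation A := (frob h t).

Definition frob_lift (a : A) : S := phi (a : {poly R})`_0 + phi (a :
  {poly R})`_1 * s.

Fact frob_lift_is_zmod_morphism : zmod_morphism frob_lift.
Proof. move=> a b; rewrite /frob_lift /= !coefB !rmorphB; ring. Qed.

Lemma frob_eq (a : A) : a = ((a : {poly R})`_0)%:A + ((a :
  {poly R})`_1)%:A * frobX h t.
Proof.
rewrite {1}(frobE a) big_bool /= addrC /basisA; congr (_ + _).
by rewrite expr1 mulr_algl.
Qed.

Lemma frob_coef (c d : R) :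
  ((c%:A + d%:A * frobX h t : A) : {poly R})`_0 = c /\
  ((c%:A + d%:A * frobX h t : A) : {poly R})`_1 = d.
Proof.
rewrite mulr_algl.
have X1 : frobX h t = 'X :> {poly R}.
  by rewrite /frobX qpolyXE ?size_frob_poly ?frob_poly_monic.
have E : (c%:A + d *: frobX h t : A) = c *: 1 + d *: 'X :> {poly R} by rewrite -X1.
by split; rewrite E !coefE /= ?mulr0 ?mulr1 ?addr0 ?add0r.
Qed.

Fact frob_lift_is_monoid_morphism : monoid_morphism frob_lift.
Proof.
have liftE c d : frob_lift (c%:A + d%:A * frobX h t) = phi c + phi d * s.
  by have [c0 d0] := frob_coef c d; rewrite /frob_lift c0 d0.
split=> [|a b].
  by have := liftE 1 0;
    rewrite !scale0r scale1r mul0r !addr0 rmorph1 rmorph0 mul0r addr0.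
rewrite (frob_eq a) (frob_eq b); set c := _`_0; set d := _`_1; set c' := _`_0;
  set d' := _`_1.
(* The same expansion [quadratic_mul] is used in A here and in [S] at the end. *)
have -> : ((c%:A + d%:A * frobX h t) * (c'%:A + d'%:A * frobX h t) : A) =
    (c * c' + d * d' * t)%:A + (c * d' + d * c' + d * d' * h)%:A * frobX h t.
  have inA (k : R) : k%:A = GRing.in_alg A k by [].
  rewrite !inA !(rmorphD, rmorphM) -!inA.
  by apply: quadratic_mul; rewrite frobX_sqr mulr_algl.
rewrite !liftE !(rmorphD, rmorphM).
by apply/esym/quadratic_mul.
Qed.

HB.instance Definition _ :=
  GRing.isZmodMorphism.Build A S frob_lift frob_lift_is_zmod_morphism.
HB.instance Definition _ :=
  GRing.isMonoidMorphism.Build A S frob_lift frob_lift_is_monoid_morphism.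

Lemma frob_evaluation :
  exists F : {rmorphism A -> S}, (forall c, F c%:A = phi c) /\ F (frobX h t) = s.
Proof.
exists frob_lift; split=> [c|].
  have [c0 c1] := frob_coef c 0; move: c0 c1;
    rewrite scale0r mul0r addr0 /= /frob_lift => -> ->.
  by rewrite rmorph0 mul0r addr0.
have [c0 c1] := frob_coef 0 1; move: c0 c1;
  rewrite scale0r scale1r mul1r add0r /= /frob_lift => -> ->.
by rewrite rmorph0 rmorph1 mul1r add0r.
Qed.

End FrobLift.

(** * The Frobenius algebras *)

Lemma int_poly_rmorph_ext (S : nzRingType) (F G : {rmorphism {poly int} -> S}) :
  F 'X = G 'X -> F =1 G.
Proof.
by apply: poly_rmorph_ext => c; rewrite -(intz c) !rmorph_int.
Qed.

Lemma int_poly_evaluation (S : comNzRingType) (s : S) :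
  exists F : {rmorphism {poly int} -> S}, F 'X = s.
Proof. by have [F [_ FX]] := poly_evaluation (intmul 1 : {rmorphism int ->
  S}) s; exists F. Qed.

Lemma frobX_roots (R : comNzRingType) (a b : R) :
  frobX (a + b) (- (a * b)) ^+ 2 =
  (a%:A + b%:A) * frobX (a + b) (- (a * b)) - a%:A * b%:A.
Proof.
rewrite frobX_sqr scaleNr -scalerDl mulr_algl; congr (_ - _).
by rewrite mulr_algl scalerA.
Qed.

Section FrobRegular.
Variables (R : comNzRingType) (h t : R).
Local Notation A := (frob h t).

Lemma frob_eq_coef (a b : A) :
  (a : {poly R})`_0 = (b : {poly R})`_0 -> (a : {poly R})`_1 = (b :
    {poly R})`_1 -> a = b.
Proof. by move=> ab0 ab1; rewrite (frob_eq a) (frob_eq b) ab0 ab1. Qed.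

Lemma frob_coefZ (c : R) (a : A) i : ((c%:A * a : A) : {poly R})`_i = c * (a :
  {poly R})`_i.
Proof. by rewrite mulr_algl -coefZ. Qed.

Lemma lreg_scalar (c : R) : GRing.lreg c -> GRing.lreg (c%:A : A).
Proof.
move=> cI a b ab; have E i : c * (a : {poly R})`_i = c * (b : {poly R})`_i.
  by rewrite -!frob_coefZ ab.
by apply: frob_eq_coef; apply: cI; apply: E.
Qed.

Lemma torsion_bound_frob n (M : 'M[R]_n) r N :
  torsion_bound M r N -> torsion_bound (map_mx (GRing.in_alg A) M) r%:A N.
Proof.
have coef_morph i : zmod_morphism (fun a : A => (a : {poly R})`_i).
  by move=> a b; rewrite /= coefB.
pose p i : {additive A -> R} :=
  HB.pack (fun a : A => (a :
    {poly R})`_i) (GRing.isZmodMorphism.Build A R _ (coef_morph i)).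
apply: (torsion_bound_free (f := GRing.in_alg A) (p := p) (e := fun i => frobX
  h t ^+ i)).
  by move=> i b a; apply: frob_coefZ.
(* A is free over [R] on 1 and X, so the coefficients from degree 2 on vanish. *)
move=> a; exists 2%N => -[|[|m]] // _.
rewrite !big_ord_recl big1 => [|i _]; last first.
  rewrite /= nth_default ?scale0r ?mul0r //.
  by rewrite (leq_trans (size_npoly a)) // mk_monic_frob size_frob_poly.
by rewrite addr0 {1}(frob_eq a) expr0 expr1 mulr1.
Qed.

End FrobRegular.

(** As x^2 = t, one more multiplication by x reduces cancelling x to cancelling t. *)
Lemma lreg_frobX (R : comNzRingType) (t : R) : GRing.lreg t ->
  GRing.lreg (frobX 0 t).
Proof.
move=> tI a b ab; apply: (lreg_scalar tI); rewrite /=.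
have x2 : t%:A = frobX 0 t * frobX 0 t by rewrite -expr2 frobX_sqr scale0r add0r.
by rewrite x2 -!mulrA ab.
Qed.

Lemma torsion_bound_polyC (R : comNzRingType) n (M : 'M[R]_n) r N :
  torsion_bound M r N -> torsion_bound (map_mx (@polyC R) M) r%:P N.
Proof.
apply: (torsion_bound_free (f := @polyC R) (p := fun i => coefp i) (e := fun i
  => 'X^i)).
  by move=> i b a; rewrite /= coefCM.
move=> a; exists (size a) => m am; apply/polyP => i.
rewrite coef_sum.
under eq_bigr do rewrite coefCM coefXn.
have [im|mi] := ltnP i m.
  rewrite (bigD1 (Ordinal im)) //= eqxx mulr1 big1 ?addr0 // => j ji.
  by rewrite -val_eqE /= eq_sym in ji; rewrite (negbTE ji) mulr0.
rewrite nth_default ?(leq_trans am) // big1 // => j _.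
by rewrite gtn_eqF ?mulr0 // (leq_trans (ltn_ord j)).
Qed.

(** Two free extensions in a row, by the powers of a variable and by 1, X. This is the extension of
    Z[G] in (i) after the change of coordinates. *)
Lemma torsion_bound_frob_polyC (R : comNzRingType) (h t : {poly R}) n (M :
  'M[R]_n) r N :
  torsion_bound M r N ->
  torsion_bound (map_mx (GRing.in_alg (frob h t) \o @polyC R) M) r%:P%:A N.
Proof.
move=> bN; have -> : map_mx (GRing.in_alg (frob h t) \o @polyC R) M =
    map_mx (GRing.in_alg (frob h t)) (map_mx (@polyC R) M).
  by apply/matrixP => i j; rewrite !mxE.
exact/torsion_bound_frob/torsion_bound_polyC.
Qed.

Lemma poly2_int_rmorph_ext (S : nzRingType) (F G :
  {rmorphism {poly {poly int}} -> S}) :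
  F 'X%:P = G 'X%:P -> F 'X = G 'X -> F =1 G.
Proof.
move=> FG1 FG2; apply: poly_rmorph_ext => // c.
suff : F \o @polyC _ =1 G \o @polyC _ by apply.
exact: int_poly_rmorph_ext.
Qed.

(** * Torsion bounds of the bracket, the unreduced complex and the unknot *)

Section Comparison.
Variable K : knot_diagram.

Lemma torsion_bound_unreduced (R : comNzRingType) (h t : R) :
  exists phi : {rmorphism {poly int} -> frob h t},
    phi 'X = 2%:R * frobX h t - h%:A /\
    forall r N, torsion_bound (diff_mx (unreduced K h t)) r N <->
      torsion_bound (map_mx phi (diff_mx (bracket K))) r N.
Proof.
have [phi phiX] := int_poly_evaluation (2%:R * frobX h t - h%:A).
exists phi; split; first exact: phiX. move=> r N.
exact: torsion_bound_conj (unreduced_bracket K phiX) (subst_mxK K (frobX h t)).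
Qed.

Lemma diff_bracket_unknot : diff_mx (bracket unknot) = 0.
Proof.
rewrite bracket_mxE; apply/matrixP => i j; rewrite !mxE /cube_coef big1 // => c.
by case: c.
Qed.

Lemma torsion_bound_lambda (S : comNzRingType) (phi : {rmorphism {poly int} ->
  S}) N :
    equivalent_up_to ('X ^+ N) (bracket K) (bracket unknot) ->
      GRing.lreg (phi 'X) ->
  torsion_bound (map_mx phi (diff_mx (bracket K))) (phi 'X) N.
Proof.
move=> [f [g [fC _ [k gf] _]]] reg.
have diffU (u : 'rV_(rank (bracket unknot))) : u *m diff_mx (bracket unknot) = 0.
  by rewrite diff_bracket_unknot mulmx0.
apply: (torsion_bound_homotopy (F := lin1_mx f) (G := lin1_mx g) (H := lin1_mx
  k)) => //.
  (* [f] sends boundaries to boundaries, and those of the unknot are zero. *)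
  apply/row_matrixP => i; rewrite row0 rowE mulmxA mul_rV_lin1.
  by have := fC (delta_mx 0 i); rewrite /diff => ->; apply: diffU.
apply/row_matrixP => i;
  rewrite !rowE mulmxBr mulmxDr !mulmxA !mul_rV_lin1 mul_mx_scalar.
exact: gf.
Qed.

End Comparison.

(** * Change of roots in a quadratic extension *)

Section RootIdentities.
Variable S : comNzRingType.
Implicit Types x y u g b c : S.

(** Subtracting the roots y and y + 2 u - g from y + u leaves u and g - u, whose product is zero. *)
Lemma root_shift y u g : u ^+ 2 = g * u ->
  (y + u) ^+ 2 = (y + (y + 2%:R * u - g)) * (y + u) - y * (y + 2%:R * u - g).
Proof.
move=> u2; apply/eqP; rewrite -subr_eq0; apply/eqP.
by transitivity (g * u - u ^+ 2); [ring|rewrite u2 subrr].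
Qed.

(** Since (x - b) (x - c) = 0, adding x - c to one factor of (x - b)^2 changes nothing. *)
Lemma root_unshift x b c : x ^+ 2 = (b + c) * x - b * c ->
  (x - b) ^+ 2 = (2%:R * x - (b + c)) * (x - b).
Proof.
move=> x2; apply/eqP; rewrite -subr_eq0; apply/eqP.
by transitivity ((b + c) * x - b * c - x ^+ 2); [ring|rewrite x2 subrr].
Qed.

Lemma discriminant_shift y u g : 2%:R * (y + u) - (y + (y + 2%:R * u - g)) = g.
Proof. ring. Qed.

Lemma second_root x b c : b + 2%:R * (x - b) - (2%:R * x - (b + c)) = c.
Proof. ring. Qed.

End RootIdentities.

(* With [u = X - a] and [G = 2 X - a - b] the relation [(X - a) (X - b) = 0]
   becomes [u ^+ 2 = G * u]. *)
Lemma frob_change_of_roots (R S : comNzRingType) (a b : R) (G Y : S)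
    (psi : {rmorphism R -> frob G 0})
    (chi : {rmorphism S -> frob (a + b) (- (a * b))}) :
    psi a = Y%:A -> psi b = Y%:A + 2%:R * frobX G 0 - G%:A ->
    chi G = 2%:R * frobX _ _ - (a + b)%:A -> chi Y = a%:A ->
    (forall F : {rmorphism R -> frob (a + b) (- (a * b))},
      F a = a%:A -> F b = b%:A -> F =1 GRing.in_alg _) ->
  exists (fwd : {rmorphism frob (a + b) (- (a * b)) -> frob G 0})
    (back : {rmorphism frob G 0 -> frob (a + b) (- (a * b))}),
    cancel fwd back /\ fwd (2%:R * frobX _ _ - (a + b)%:A) = G%:A.
Proof.
move=> psia psib chiG chiY uniq; pose A := frob (a + b) (- (a * b)).
pose x : A := frobX _ _; pose u : frob G 0 := frobX G 0.
have abA : (a + b)%:A = a%:A + b%:A :> A by rewrite scalerDl.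
have u2 : u ^+ 2 = G%:A * u by rewrite frobX_sqr scale0r addr0 mulr_algl.
(* [fwd] sends X to Y + u, and [back] below sends u to X - a. *)
have [|fwd [fwdC fwdX]] :=
    @frob_evaluation _ _ psi (a + b) (- (a * b)) (Y%:A + frobX G 0).
  by rewrite rmorphN rmorphM rmorphD psia psib; exact: root_shift.
have [|back [backC backX]] := @frob_evaluation _ _ chi G 0 (x - a%:A).
  by rewrite rmorph0 addr0 chiG abA; exact/root_unshift/frobX_roots.
exists fwd, back; split; last first.
  rewrite rmorphB rmorphM rmorph_nat fwdX fwdC rmorphD psia psib.
  exact: discriminant_shift.
(* On scalars the composite is determined by its values at [a] and [b], by [uniq]. *)
have backfwd : back \o fwd \o GRing.in_alg A =1 GRing.in_alg A.
  apply: uniq; first by rewrite /= fwdC psia backC.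
  rewrite /= fwdC psib rmorphB rmorphD rmorphM rmorph_nat !backC backX chiY
    chiG abA.
  exact: second_root.
move=> c; rewrite (frob_eq c) !(rmorphD, rmorphM) fwdX rmorphD backX backC chiY.
have E d : back (fwd d%:A) = d%:A := backfwd d.
by rewrite !E [_ + (x - _)]addrC subrK.
Qed.

(** * The four comparisons *)

Section Main.
Variable K : knot_diagram.

Lemma torsion_bound_nu N (a1 := ('X%:P : {poly {poly int}})) (a2 := ('X :
  {poly {poly int}}))
    (h := a1 + a2) (t := - (a1 * a2)) :
  torsion_bound (diff_mx (bracket K)) 'X N <->
  torsion_bound (diff_mx (unreduced K h t)) (2%:R * frobX h t - h%:A) N.
Proof.
have [phi [phiX ->]] := torsion_bound_unreduced K h t; rewrite -phiX.
split; last first.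
  (* The retraction [rho] sets alpha_1 = 0 and alpha_2 = X = G, so 2 X - alpha_1 - alpha_2 goes to
     G. *)
  have [psi0 psi0X] := int_poly_evaluation (0 : {poly int}).
  have [psi [psiC psiX]] := poly_evaluation psi0 ('X : {poly int}).
  have [|rho [rhoC rhoX]] := @frob_evaluation _ _ psi h t ('X : {poly int}).
    by rewrite /h /t rmorphN rmorphM rmorphD /a1 /a2 psiC psi0X psiX; ring.
  apply: (torsion_bound_retract (f := phi) (g := rho)) => p.
  rewrite -[rho _]/((rho \o phi) p) -[RHS]/(idfun p); apply: int_poly_rmorph_ext.
  rewrite /= phiX rmorphB rmorphM rmorph_nat rhoX rhoC /h rmorphD /a1 /a2 psiC
    psi0X psiX.
  ring.
(* Coordinates Y = alpha_1 and u = X - alpha_1 turn the algebra into [frob G 0] over Z[G][Y], which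
   is visibly free over Z[G]. *)
move=> bN; pose G : {poly {poly int}} := 'X%:P; pose Y : {poly {poly int}} := 'X.
have [psi0 psi0X] := int_poly_evaluation (Y%:A : frob G 0).
have [psi [psiC psi2]] :=
  poly_evaluation psi0 (Y%:A + 2%:R * frobX G 0 - G%:A : frob G 0).
have psi1 : psi a1 = Y%:A by rewrite psiC psi0X.
have [chi [chiC chiX]] := poly_evaluation phi (a1%:A : frob h t).
have chiG : chi G = 2%:R * frobX h t - h%:A by exact: etrans (chiC _) phiX.
have [F F1 F2|fwd [back [fwdK fwdG]]] := frob_change_of_roots psi1 psi2 chiG chiX.
  exact: poly2_int_rmorph_ext.
apply: (torsion_bound_retract_comp (d := GRing.in_alg (frob G 0) \o @polyC _) _
  fwdK).
  by apply: int_poly_rmorph_ext; exact: etrans (congr1 fwd phiX) fwdG.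
exact: torsion_bound_frob_polyC.
Qed.

Lemma torsion_bound_Q N :
  torsion_bound (diff_mx (bracket K)) 'X N ->
  torsion_bound (diff_mx (unreduced K 0 ('X : {poly rat}))) (frobX 0 'X) N.
Proof.
move=> bN; have [phi [phiX bE]] := torsion_bound_unreduced K 0 ('X : {poly rat}).
pose A := frob 0 ('X : {poly rat}); pose x : A := frobX 0 'X.
have {}phiX : phi 'X = 2%:R * x by rewrite phiX scale0r subr0.
have ratC (q : rat) : ((GRing.in_alg A \o @polyC rat) : {rmorphism rat ->
  A}) q = q%:P%:A by [].
have ratN n : n.+1%:R * (n.+1%:R^-1)%:P%:A = 1 :> A.
  by rewrite -ratC -(rmorph_nat (GRing.in_alg A \o @polyC rat)) -rmorphM divff
    ?rmorph1 // pnatr_eq0.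
apply: (torsion_bound_unit (c := 2%:R) (c' := (2%:R^-1)%:P%:A)).
  by rewrite mulrC ratN.
rewrite -phiX; apply/bE; apply: torsion_bound_fraction bN.
  (* Injectivity of [phi]: with X sent to G/2 and t to (G/2)^2, the composite [rho \o phi] is the
     inclusion of Z[G] in Q[G]. *)
  have [psi [psiC psiX]] := poly_evaluation (@polyC rat) ((2%:R^-1 *: 'X) ^+ 2
    : {poly rat}).
  have [|rho [rhoC rhoX]] := @frob_evaluation _ _ psi 0 'X (2%:R^-1 *: 'X :
    {poly rat}).
    by rewrite rmorph0 mul0r add0r psiX.
  have E : rho \o phi =1 map_poly (intmul 1).
    apply: int_poly_rmorph_ext.
    rewrite /= phiX map_polyX rmorphM rmorph_nat rhoX mulr_natl -scaler_nat
      scalerA divff ?scale1r //.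
  move=> p q /(congr1 rho); rewrite -![rho _]/((rho \o phi) _) !E.
  by apply: map_inj_poly; [exact: intr_inj|rewrite mulr0z].
suff fracA (a : A) : is_fraction phi a by exact: fracA.
(* x = G/2 and the rationals are fractions; as t = x^2, they generate A as a ring. *)
have frac2 : is_fraction phi x.
  exists 2%:R, 'X, (2%:R^-1)%:P%:A; rewrite rmorph_nat; split; last by rewrite phiX.
  by rewrite mulrC ratN.
have fracQ (q : rat) : is_fraction phi q%:P%:A.
  have [n [m qE]] : exists n (m : int), q = m%:~R / n.+1%:R.
    exists (`|denq q|.-1)%N, (numq q).
    by rewrite prednK ?absz_gt0 ?denq_neq0 // -[LHS]divq_num_den;
      congr (_ / _); rewrite pmulrn absz_denq.
  exists n.+1%:R, m%:~R, (n.+1%:R^-1)%:P%:A; rewrite rmorph_nat rmorph_int; split.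
    by rewrite mulrC ratN.
  rewrite -ratC -(rmorph_nat (GRing.in_alg A \o @polyC rat)) -rmorphM qE mulrC
    divfK ?rmorph_int //.
  by rewrite pnatr_eq0.
have fracR (r : {poly rat}) : is_fraction phi (r%:A : A).
  elim/poly_ind: r => [|r q IHr]; first by rewrite -[0%:A]/(0%:P%:A); apply: fracQ.
  rewrite -[_%:A]/(GRing.in_alg A _) rmorphD rmorphM; apply: fractionD;
    last exact: fracQ.
  apply: fractionM => //; rewrite /=; have -> : 'X%:A = x * x :> A.
    by rewrite -expr2 frobX_sqr scale0r add0r.
  exact: fractionM.
by rewrite (frob_eq a); apply: fractionD => //; apply: fractionM.
Qed.

Lemma torsion_bound_F2 N :
    equivalent_up_to ('X ^+ N) (bracket K) (bracket unknot) ->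
  torsion_bound (diff_mx (unreduced K ('X : {poly 'F_2}) 0)) 'X%:A N.
Proof.
move=> eqN; have [phi [phiX bE]] := torsion_bound_unreduced K ('X : {poly 'F_2}) 0.
(* In characteristic 2 the term 2 x vanishes, so G goes to -h, a regular scalar. *)
pose A := frob ('X : {poly 'F_2}) 0.
have A2 : 2%:R = 0 :> A.
  have -> : 2%:R = (2%:R : {poly 'F_2})%:A :> A by rewrite scaler_nat.
  suff -> : 2%:R = 0 :> {poly 'F_2} by rewrite scale0r.
  by rewrite -polyC_natr pchar_Fp_0.
have {}phiX : phi 'X = -1 * 'X%:A by rewrite phiX A2 mul0r sub0r mulN1r.
apply: (torsion_bound_unit (c := -1) (c' := -1)); first by rewrite mulrNN mulr1.
rewrite -phiX; apply/bE/torsion_bound_lambda => //.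
rewrite phiX mulN1r; apply/lregN/lreg_scalar => p q.
by apply: mulfI; rewrite polyX_eq0.
Qed.

Lemma torsion_bound_Fp p N : prime p -> odd p ->
    equivalent_up_to ('X ^+ N) (bracket K) (bracket unknot) ->
  torsion_bound (diff_mx (unreduced K 0 ('X : {poly 'F_p}))) (frobX 0 'X) N.
Proof.
move=> pp po eqN; have [phi [phiX bE]] := torsion_bound_unreduced K 0 ('X :
  {poly 'F_p}).
pose A := frob 0 ('X : {poly 'F_p}); pose x : A := frobX 0 'X.
have {}phiX : phi 'X = 2%:R * x by rewrite phiX scale0r subr0.
(* Oddness of [p] makes 2 a unit; then 2 x is regular because x is. *)
have n2 : (2%:R : 'F_p) != 0.
  rewrite -(dvdn_pcharf (pchar_Fp pp)); apply: contraL po => p2.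
  by have /eqP -> : p == 2%N by rewrite eqn_leq prime_gt1 // dvdn_leq.
have c2 : (2%:R^-1)%:P%:A * 2%:R = 1 :> A.
  by rewrite mulr_natr -scaler_nat scalerA -polyC_natr -polyCM divff ?scale1r.
apply: (torsion_bound_unit c2).
rewrite -phiX; apply/bE/torsion_bound_lambda => //.
rewrite phiX; apply: lregM.
  by apply: (@GRing.lregMl _ (2%:R^-1)%:P%:A); rewrite c2; exact: lreg1.
by apply: lreg_frobX => a b; apply: mulfI; rewrite polyX_eq0.
Qed.

End Main.

Theorem proposition3p22 (K : knot_diagram) :
  [/\ u_G K = nu K,
      enat_le (u_X K) (u_G K),
      (forall p : nat, prime p -> odd p -> enat_le (u_Xp p K) (lambda K))
    & enat_le (u_h K) (lambda K)].
Proof.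
(* With every invariant written as an [enat_min], (i) becomes an equality of sets of bounds and the
   inequalities become inclusions. *)
rewrite /u_G /nu /u_X /u_Xp /u_Xfield /u_h /lambda !max_torsion_orderE; split.
- by congr enat_min; apply/funext => N; apply/propext; apply: torsion_bound_nu.
- by apply: enat_le_min => N; apply: torsion_bound_Q.
- move=> p pp po; rewrite max_torsion_orderE; apply: enat_le_min => N.
  exact: torsion_bound_Fp.
- by apply: enat_le_min => N; apply: torsion_bound_F2.
Qed.
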